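(* Assume that (i) there exists $\beta>0$ such that $$\lim_{|p|\to+\infty}\left(\beta|H(x,p)|^2+D_xH(x,p)\cdot p\right)=\lim_{|p|\to+\infty}\frac{H(x,p)}{|p|}=+\infty\quad\text{uniformly in }x\in\overline U,$$ and (ii) there exists $\Phi\in C^2(U)\cap C^1(\overline U)$ with $\Phi\le\psi$ on $\overline U$, $\Phi=0$ on $\partial U$ and $\Phi+H(x,D\Phi)<0$ in $\overline U$. Let $u^\varepsilon$ be the smooth solution of the penalized problem and let $u$ be the viscosity solution of the obstacle problem obtained as uniform limit of $u^\varepsilon$ (both problems are written in the context). Then there exist $\varepsilon_0>0$ and a constant $C>0$, independent of $\varepsilon$, such that for all $\varepsilon\in(0,\varepsilon_0)$ $$\|u^\varepsilon-u\|_{L^\infty}\le C\varepsilon^{1/2}.$$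
   Context: $U\subset\mathbb R^n$ ($n\ge2$) is an open bounded domain with smooth boundary; $\psi:\overline U\to\mathbb R$ and $H:\overline U\times\mathbb R^n\to\mathbb R$, $(x,p)\mapsto H(x,p)$, are smooth, with $\psi\ge0$ on $\partial U$. $H$ is not assumed convex in $p$. Obstacle problem: $\max\{u-\psi,\,u+H(x,Du)\}=0$ in $U$, $u=0$ on $\partial U$ (viscosity sense). Let $\gamma:\mathbb R\to[0,+\infty)$ be smooth with $\gamma(s)=0$ for $s\le0$, $\gamma(s)>0$ and $0<\gamma'(s)\le1$ for $s>0$, and $\lim_{s\to+\infty}\gamma(s)=+\infty$. Set $\gamma^\varepsilon(s):=\gamma(s/\varepsilon)$ for $\varepsilon>0$. Penalized problem: $u^\varepsilon+H(x,Du^\varepsilon)+\gamma^\varepsilon(u^\varepsilon-\psi)=\varepsilon\Delta u^\varepsilon$ in $U$, $u^\varepsilon=0$ on $\partial U$. Under the assumptions of the claim a smooth solution $u^\varepsilon$ exists (known result), and $u^\varepsilon$ converges uniformly, up to subsequences as $\varepsilon\to0$, to a viscosity solution $u$ of the obstacle problem. *)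

(* Defs.v *)
From HB Require Import structures.
From mathcomp Require Import all_boot all_order all_algebra.
From mathcomp Require Import all_classical all_reals all_analysis.

Set Implicit Arguments.
Unset Strict Implicit.
Unset Printing Implicit Defensive.

Import Order.TTheory GRing.Theory Num.Theory.
Import numFieldNormedType.Exports.
Local Open Scope classical_set_scope.
Local Open Scope ring_scope.

(* The norm of the normedModType structure on ['rV[R]_n] is the sup norm, so
   the Euclidean structure of R^n is given separately. *)
Definition dotv (R : realType) (n : nat) (p q : 'rV[R]_n) : R :=
  \sum_(i < n) p 0 i * q 0 i.

Definition enorm (R : realType) (n : nat) (p : 'rV[R]_n) : R :=
  Num.sqrt (dotv p p).

Definition boundary (T : topologicalType) (A : set T) : set T :=
  closure A `\` interior A.

Definition iter_derive (R : realType) (V : normedModType R) (vs : seq V)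
    (f : V -> R) : V -> R :=
  foldr (fun v g => fun x => 'D_v g x) f vs.

(* f is C^k in the open set A.  In finite dimension, asking for all iterated
   directional derivatives is the same as asking for all partial derivatives,
   and does not single out a basis of V (which is ['rV_n], R or a product). *)
Definition Ck (R : realType) (V : normedModType R) (k : nat) (A : set V)
    (f : V -> R) : Prop :=
  forall vs : seq V, (size vs <= k)%N ->
    (forall x, A x -> {for x, continuous (iter_derive vs f)}) /\
    ((size vs < k)%N ->
     forall v x, A x -> derivable (iter_derive vs f) x v).

Definition Cinf (R : realType) (V : normedModType R) (A : set V)
    (f : V -> R) : Prop :=
  forall k, Ck k A f.

(* C^k up to the boundary, i.e. C^k (closure A) for A open: every derivative
   of order at most k in A extends continuously to [closure A]; for order 0
   the extension is f itself. *)
Definition Ck_bar (R : realType) (V : normedModType R) (k : nat) (A : set V)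
    (f : V -> R) : Prop :=
  [/\ Ck k A f,
      {within closure A, continuous f} &
      forall vs : seq V, (size vs <= k)%N ->
        exists2 g : V -> R, {within closure A, continuous g} &
                            forall x, A x -> g x = iter_derive vs f x].

Definition Cinf_bar (R : realType) (V : normedModType R) (A : set V)
    (f : V -> R) : Prop :=
  forall k, Ck_bar k A f.

Definition grad (R : realType) (n : nat) (f : 'rV[R]_n -> R) (x : 'rV[R]_n) :
    'rV[R]_n :=
  \row_(i < n) 'D_(delta_mx 0 i) f x.

Definition laplacian (R : realType) (n : nat) (f : 'rV[R]_n -> R)
    (x : 'rV[R]_n) : R :=
  \sum_(i < n) 'D_(delta_mx 0 i) (fun y => 'D_(delta_mx 0 i) f y) x.

(* Continuous extension to [closure U] of the gradient of f in U; for f in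
   C^1 (closure U) the limits exist, and in the open set U it is [grad f]. *)
Definition grad_bar (R : realType) (n : nat) (U : set 'rV[R]_n)
    (f : 'rV[R]_n -> R) (x : 'rV[R]_n) : 'rV[R]_n :=
  \row_(i < n) lim ((grad f y 0 i) @[y --> within U (nbhs x)]).

(* Near each boundary point, after relabelling and reorienting the axes, U is
   the strict epigraph of a smooth function of n - 1 variables; [col' i x] is
   x without its i-th coordinate. *)
Definition smooth_boundary (R : realType) (n : nat) (U : set 'rV[R]_n) : Prop :=
  forall x0, boundary U x0 ->
    exists (r : R) (i : 'I_n) (s : bool) (g : 'rV[R]_n.-1 -> R),
      [/\ 0 < r, Cinf setT g &
          U `&` ball x0 r =
          [set x | g (col' i x) < (-1) ^+ s * x 0 i] `&` ball x0 r].

Definition smooth_bounded_domain (R : realType) (n : nat)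
    (U : set 'rV[R]_n) : Prop :=
  [/\ U !=set0, open U, connected U, bounded_set U & smooth_boundary U].

Definition tends_to_pinfty_unif (R : realType) (n : nat) (A : set 'rV[R]_n)
    (G : 'rV[R]_n -> 'rV[R]_n -> R) : Prop :=
  forall M : R, exists r : R, forall x p : 'rV[R]_n,
    A x -> r < enorm p -> M < G x p.

Definition penalization (R : realType) (gamma : R -> R) : Prop :=
  [/\ Cinf setT gamma,
      forall s, 0 <= gamma s,
      forall s, s <= 0 -> gamma s = 0,
      forall s, 0 < s -> 0 < gamma s /\ 0 < derive1 gamma s <= 1 &
      gamma s @[s --> +oo] --> +oo].

Definition penalized_solution (R : realType) (n : nat) (U : set 'rV[R]_n)
    (H : 'rV[R]_n -> 'rV[R]_n -> R) (psi : 'rV[R]_n -> R) (gamma : R -> R)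
    (eps : R) (u : 'rV[R]_n -> R) : Prop :=
  [/\ Cinf_bar U u,
      forall x, U x ->
        u x + H x (grad u x) + gamma ((u x - psi x) / eps)
        = eps * laplacian u x &
      forall x, boundary U x -> u x = 0].

(* Viscosity sub- and supersolutions of the first-order equation
   F (x, u, Du) = 0 in the open set U, with C^1 test functions. *)
Definition viscosity_subsolution (R : realType) (n : nat) (U : set 'rV[R]_n)
    (F : 'rV[R]_n -> R -> 'rV[R]_n -> R) (u : 'rV[R]_n -> R) : Prop :=
  forall (phi : 'rV[R]_n -> R) (x0 : 'rV[R]_n), Ck 1 U phi -> U x0 ->
    (\forall x \near x0, u x - phi x <= u x0 - phi x0) ->
    F x0 (u x0) (grad phi x0) <= 0.

Definition viscosity_supersolution (R : realType) (n : nat) (U : set 'rV[R]_n)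
    (F : 'rV[R]_n -> R -> 'rV[R]_n -> R) (u : 'rV[R]_n -> R) : Prop :=
  forall (phi : 'rV[R]_n -> R) (x0 : 'rV[R]_n), Ck 1 U phi -> U x0 ->
    (\forall x \near x0, u x0 - phi x0 <= u x - phi x) ->
    0 <= F x0 (u x0) (grad phi x0).

Definition obstacle_viscosity_solution (R : realType) (n : nat)
    (U : set 'rV[R]_n) (H : 'rV[R]_n -> 'rV[R]_n -> R) (psi : 'rV[R]_n -> R)
    (u : 'rV[R]_n -> R) : Prop :=
  let F x z p := Num.max (z - psi x) (z + H x p) in
  [/\ {within closure U, continuous u},
      viscosity_subsolution U F u,
      viscosity_supersolution U F u &
      forall x, boundary U x -> u x = 0].

(* L^oo norm of f on the open set U.  It is only used for f continuous in U,
   where the essential supremum of |f| is its supremum. *)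
Definition Linfty_norm (R : realType) (n : nat) (U : set 'rV[R]_n)
    (f : 'rV[R]_n -> R) : \bar R :=
  ereal_sup [set (`|f x|)%:E | x in U].

(* Main.v *)
Require Import Defs.
From HB Require Import structures.
From mathcomp Require Import all_boot all_order all_algebra.
From mathcomp Require Import all_classical all_reals all_analysis.
From mathcomp Require Import ring lra.

Set Implicit Arguments.
Unset Strict Implicit.
Unset Printing Implicit Defensive.

Import Order.TTheory GRing.Theory Num.Theory.
Import numFieldNormedType.Exports.
Local Open Scope classical_set_scope.
Local Open Scope ring_scope.

(** Let v and w solve the penalized problem with parameters eps and del, both
    at most s^2.  The heart of the proof is that v - w <= C s in U with C
    independent of eps, del and s ([penalized_solutions_close]).  Exchanging v
    and w, and letting del run to 0 along the sequence for which the solutions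
    converge to u, one gets |u^eps - u| <= C eps^(1/2).

    The comparison of v and w doubles the variables: let (x0, y0) maximise
    v(x) - w(y) - |x - y|^2 / (2 s) over pairs of points of the closure of U.
    If both points are in U, then Dv(x0) = Dw(y0) = p with p = (x0 - y0) / s,
    while eps Lap v(x0) <= n s and del Lap w(y0) >= - n s.  So the equation of v
    at x0 bounds H(x0, p) + gamma((v - psi) / eps) from above.  Since H is
    coercive this bounds p, hence |x0 - y0| <= L s, and since gamma tends to
    infinity it also gives v(x0) <= psi(x0) + Gam eps.  If w(y0) <= psi(y0),
    the penalty of w vanishes at y0 and subtracting the two equations gives
    v(x0) - w(y0) <= H(y0, p) - H(x0, p) + 2 n s = O(s); otherwise
    v(x0) - w(y0) <= psi(x0) - psi(y0) + Gam eps = O(s).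

    Barriers deal with the case of a point on the boundary.  From below,
    v >= Phi - C eps ([penalized_ge_subsolution]): at a minimum point x0 of
    v - Phi one compares v, at distance of order eps from x0, with the first
    order Taylor polynomial of Phi minus a quadratic of opening 1 / eps.  Its
    gradient stays close to DPhi and eps times its Laplacian stays small, so it
    inherits the strict subsolution property of Phi although D^2 Phi may blow
    up at the boundary.  From above, v grows at most quadratically away from a
    boundary point, up to O(s) ([penalized_boundary_growth]): a paraboloid
    centred at an exterior point at distance of order s is a supersolution, as
    its gradient is large everywhere in U.

    All test functions are quadratic polynomials, so that the maximum
    principle reduces to second-derivative tests along the axes.

    The segment between two points of U may leave U.  The Lipschitz bounds
    and the Taylor expansion up to the boundary rest on paths that go around
    obstructions: in a boundary chart one moves inwards, then sideways, then
    back, along the axes, so that only partial derivatives matter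
    ([detour_boundary]).  A covering argument makes the constants uniform. *)

(** * The sup norm and the scalar product on rows *)

Lemma norm_coord_le (R : realType) (n : nat) (x : 'rV[R]_n) (i : 'I_n) :
  `|x 0 i| <= `|x|.
Proof.
rewrite [leRHS]mx_normrE.
exact: (le_trans _ (le_bigmax _ _ (0, i))).
Qed.

Lemma norm_row_le (R : realType) (n : nat) (x : 'rV[R]_n) (r : R) :
  0 <= r -> (forall i, `|x 0 i| <= r) -> `|x| <= r.
Proof.
move=> r0 xr; rewrite [leLHS]mx_normrE.
by apply: bigmax_le => // -[i j] _ /=; rewrite (ord1 i).
Qed.

Lemma norm_row_lt (R : realType) (n : nat) (x : 'rV[R]_n) (r : R) :
  0 < r -> (forall i, `|x 0 i| < r) -> `|x| < r.
Proof.
move=> r0 xr; rewrite [ltLHS]mx_normrE.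
by apply: bigmax_lt => // -[i j] _ /=; rewrite (ord1 i).
Qed.

Lemma row_subE (R : realType) (n : nat) (x y : 'rV[R]_n) (i : 'I_n) :
  (x - y) 0 i = x 0 i - y 0 i.
Proof. by rewrite !mxE. Qed.

Lemma sqr_norm_le_dotv (R : realType) (n : nat) (x : 'rV[R]_n) :
  `|x| ^+ 2 <= dotv x x.
Proof.
have dotv_ge0 : 0 <= dotv x x by apply: sumr_ge0 => i _; rewrite -expr2 sqr_ge0.
rewrite -(sqr_sqrtr dotv_ge0) lerXn2r ?nnegrE ?sqrtr_ge0//.
apply: norm_row_le => [|i]; first exact: sqrtr_ge0.
rewrite -sqrtr_sqr ler_sqrt// /dotv (bigD1 i)//= -expr2 lerDl.
by apply: sumr_ge0 => j _; rewrite -expr2 sqr_ge0.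
Qed.

Lemma dotv_le_sqr_norm (R : realType) (n : nat) (x : 'rV[R]_n) :
  dotv x x <= n%:R * `|x| ^+ 2.
Proof.
apply: (@le_trans _ _ (\sum_(i < n) `|x| ^+ 2)).
  by apply: ler_sum => i _;
    rewrite -expr2 -real_normK ?num_real// lerXn2r ?nnegrE ?norm_coord_le.
by rewrite sumr_const card_ord mulr_natl.
Qed.

Lemma norm_le_enorm (R : realType) (n : nat) (x : 'rV[R]_n) : `|x| <= enorm x.
Proof.
rewrite -[leLHS]normr_id -sqrtr_sqr.
exact/ler_wsqrtr/sqr_norm_le_dotv.
Qed.

Lemma dotvDD (R : realType) (n : nat) (x y : 'rV[R]_n) :
  dotv (x + y) (x + y) = dotv x x + 2 * dotv x y + dotv y y.
Proof.
rewrite /dotv mulr_sumr -!big_split/=; apply: eq_bigr => i _.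
by rewrite !mxE; ring.
Qed.

Lemma dotvC (R : realType) (n : nat) (x y : 'rV[R]_n) : dotv x y = dotv y x.
Proof. by apply: eq_bigr => i _; rewrite mulrC. Qed.

Lemma dotvZl (R : realType) (n : nat) (k : R) (x y : 'rV[R]_n) :
  dotv (k *: x) y = k * dotv x y.
Proof.
by rewrite /dotv mulr_sumr; apply: eq_bigr => i _; rewrite !mxE mulrA.
Qed.

Lemma dotvDl (R : realType) (n : nat) (x y z : 'rV[R]_n) :
  dotv (x + y) z = dotv x z + dotv y z.
Proof.
by rewrite /dotv -big_split; apply: eq_bigr => i _; rewrite !mxE mulrDl.
Qed.

Lemma dotv_delta (R : realType) (n : nat) (x : 'rV[R]_n) (i : 'I_n) :
  dotv x (delta_mx 0 i) = x 0 i.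
Proof.
rewrite /dotv (bigD1 i)//= mxE !eqxx mulr1 big1 ?addr0// => j /negPf ji.
by rewrite mxE ji andbF mulr0.
Qed.

Lemma dotv_ge0 (R : realType) (n : nat) (x : 'rV[R]_n) : 0 <= dotv x x.
Proof. by apply: sumr_ge0 => i _; rewrite -expr2 sqr_ge0. Qed.

Lemma dotvDD_le (R : realType) (n : nat) (x y : 'rV[R]_n) :
  dotv (x + y) (x + y) <= 2 * dotv x x + 2 * dotv y y.
Proof.
have := dotv_ge0 (x - y); rewrite dotvDD [dotv x (- y)]dotvC -scaleN1r !dotvZl.
rewrite [dotv y (_ *: y)]dotvC dotvZl dotvDD (dotvC y x); lra.
Qed.

Lemma dotv_distC (R : realType) (n : nat) (x y : 'rV[R]_n) :
  dotv (x - y) (x - y) = dotv (y - x) (y - x).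
Proof. by rewrite -opprB -scaleN1r dotvZl dotvC dotvZl mulrA mulrNN !mul1r. Qed.

(** A quadratic tangent at one point is rewritten around another one: this
    turns an extremum of a difference with a global quadratic into the form
    expected by the second-derivative tests. *)
Lemma quadratic_recenter (R : realType) (n : nat) (q c x y : 'rV[R]_n) (a : R) :
  dotv q (x - c) + a * dotv (x - c) (x - c) =
  dotv q (y - c) + a * dotv (y - c) (y - c)
  + dotv (q + (2 * a) *: (y - c)) (x - y) + a * dotv (x - y) (x - y).
Proof.
have -> : x - c = (x - y) + (y - c) by rewrite subrKA.
move: (x - y) (y - c) => X Y.
by rewrite dotvDD dotvDl dotvZl !(dotvC q) dotvDl (dotvC Y X); ring.
Qed.

Lemma axis_entry (R : realType) (n : nat) (x : 'rV[R]_n) (t : R) (i j : 'I_n) :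
  (x + t *: delta_mx 0 i) 0 j = if j == i then x 0 i + t else x 0 j.
Proof.
rewrite !mxE; case: (eqVneq j i) => [->|_]; first by rewrite mulr1.
by rewrite andbF mulr0 addr0.
Qed.

(** * Increments along the axes *)

(** A directional derivative is the derivative of a function of one real
    variable; this equality of difference quotients transfers both
    derivability and the value of the derivative. *)
Lemma quotient_along_line (R : realType) (V : normedModType R) (f : V -> R)
    (x v : V) (t : R) :
  (fun h => h^-1 *: (((fun s => f (x + s *: v)) \o shift t) (h *: 1)
                      - f (x + t *: v))) =
  (fun h => h^-1 *: ((f \o shift (x + t *: v)) (h *: v) - f (x + t *: v))).
Proof.
apply/funext => h /=; congr (_ *: (f _ - _)).
by rewrite -[h *: 1]/(h * 1) mulr1 scalerDl addrCA.
Qed.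

Lemma is_derive_along_line (R : realType) (V : normedModType R) (f : V -> R)
    (x v : V) (t : R) : derivable f (x + t *: v) v ->
  is_derive t 1 (fun s => f (x + s *: v)) ('D_v f (x + t *: v)).
Proof.
move=> df; split; last by rewrite /derive quotient_along_line.
by rewrite /derivable quotient_along_line.
Qed.

Lemma increment_along_segment (R : realType) (V : normedModType R)
    (f : V -> R) (x v : V) (c B : R) : 0 <= c ->
  (forall t, 0 <= t <= c ->
     derivable f (x + t *: v) v /\ `|'D_v f (x + t *: v)| <= B) ->
  `|f (x + c *: v) - f x| <= B * c.
Proof.
move=> c0 fB.
have [||t t0c] := @MVT_segment R (fun s => f (x + s *: v))
    (fun s => 'D_v f (x + s *: v)) 0 c c0.
- move=> t; rewrite in_itv/= => /andP[t0 tc]; apply: is_derive_along_line.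
  by have [] := fB t (introT andP (conj (ltW t0) (ltW tc))).
- apply: derivable_within_continuous => t; rewrite in_itv/= => tc.
  by have [/is_derive_along_line/@ex_derive] := fB t tc.
- rewrite scale0r addr0 subr0 => ->; rewrite normrM (ger0_norm c0) ler_wpM2r//.
  by have [|] := fB t; rewrite ?in_itv in t0c *.
Qed.

Definition inbox (R : realType) (n : nat) (a b z : 'rV[R]_n) : Prop :=
  forall j, Num.min (a 0 j) (b 0 j) <= z 0 j <= Num.max (a 0 j) (b 0 j).

(** Going from a to b one coordinate at a time stays in the box spanned by a
    and b, so the mean value theorem applies to one
    partial derivative at a time. *)
Lemma increment_in_box (R : realType) (n : nat) (f : 'rV[R]_n -> R)
    (a b : 'rV[R]_n) (B : R) :
  (forall z, inbox a b z -> forall j, derivable f z (delta_mx 0 j) /\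
     `|'D_(delta_mx 0 j) f z| <= B) ->
  `|f b - f a| <= n%:R * B * `|b - a|.
Proof.
move=> fB.
(* The vertices of the path: the first k coordinates have been moved. *)
pose z k : 'rV[R]_n := \row_j (if (j < k)%N then b 0 j else a 0 j).
have step (k : 'I_n) : `|f (z k.+1) - f (z k)| <= B * `|b - a|.
  pose e : 'rV[R]_n := delta_mx 0 k.
  have zE (t : R) : z k + t *: e =
      \row_j (if (j < k)%N then b 0 j else if j == k then a 0 k + t else a 0 j).
    apply/rowP => j; rewrite !mxE; case: (eqVneq j k) => [->|jk].
      by rewrite ltnn eqxx mulr1.
    by rewrite andbF mulr0 addr0.
  have zSE : z k.+1 = z k + (b 0 k - a 0 k) *: e.
    rewrite zE; apply/rowP => j; rewrite !mxE ltnS leq_eqVlt -(inj_eq val_inj).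
    case: eqVneq => [/val_inj ->|_] //=; first by rewrite ltnn addrC subrK.
  have inb (t : R) :
      Num.min (a 0 k) (b 0 k) <= a 0 k + t <= Num.max (a 0 k) (b 0 k) ->
      inbox a b (z k + t *: e).
    move=> tk j; rewrite zE mxE; case: ifP => _.
      by rewrite ge_min le_max lexx !orbT.
    by case: eqP => [->//|_]; rewrite ge_min le_max lexx.
  have B0 : 0 <= B.
    have [|_] := fB a _ k; last exact: le_trans.
    by move=> j; rewrite ge_min le_max lexx.
  have ab : `|b 0 k - a 0 k| <= `|b - a|.
    by have := norm_coord_le (b - a) k; rewrite !mxE.
  apply: (@le_trans _ _ (B * `|b 0 k - a 0 k|)); last by rewrite ler_wpM2l.
  have [akbk|bkak] := leP (a 0 k) (b 0 k).
    rewrite zSE (ger0_norm (x := b 0 k - a 0 k)) ?subr_ge0//.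
    apply: increment_along_segment => [|t /andP[t0 tba]];
      first by rewrite subr_ge0.
    by apply: fB; apply: inb; rewrite min_l// max_r//; lra.
  have zkE : z k = z k.+1 + (a 0 k - b 0 k) *: e.
    by rewrite zSE -addrA -scalerDl addrC subrKA subrr scale0r add0r.
  rewrite (distrC (b 0 k)) (distrC (f _)) {1}zkE.
  rewrite (gtr0_norm (x := a 0 k - b 0 k)) ?subr_gt0//.
  apply: increment_along_segment => [|t /andP[t0 tba]];
    first by rewrite subr_ge0 ltW.
  rewrite zSE -addrA -scalerDl.
  by apply: fB; apply: inb; rewrite (min_r (ltW bkak)) (max_l (ltW bkak)); lra.
have -> : f b - f a = \sum_(k < n) (f (z k.+1) - f (z k)).
  rewrite -(big_mkord xpredT (fun k => f (z k.+1) - f (z k))) telescope_sumr//.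
  congr (f _ - f _); apply/rowP => j; rewrite mxE//.
  by rewrite ltn_ord.
apply: le_trans (ler_norm_sum _ _ _) _.
apply: (le_trans (ler_sum _ (fun k _ => step k))).
by rewrite sumr_const card_ord -mulrA mulr_natl.
Qed.

Lemma near_along_line (R : realType) (V : normedModType R) (x v : V)
    (P : set V) : nbhs x P -> \forall t \near (0 : R), P (x + t *: v).
Proof.
move=> xP; have cv : (fun t : R => x + t *: v) @ (0 : R) --> x + (0 : R) *: v.
  apply: cvgD; first exact: cvg_cst.
  exact: scalel_continuous.
by apply: cv; rewrite scale0r addr0.
Qed.

(** * Second-derivative tests against quadratics *)

(** Let g(t) be f minus the quadratic along the line: g has a local maximum at
    0, so g'(0) = 0.  If g''(0) were positive, g' would be positive just after
    0 and g would exceed g(0) there, by the mean value theorem. *)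
Lemma second_derivative_test (R : realType) (V : normedModType R) (f : V -> R)
    (x0 v : V) (b a : R) :
  (\forall x \near x0, derivable f x v) ->
  derivable ('D_v f) x0 v ->
  (\forall t \near (0 : R), f (x0 + t *: v) <= f x0 + b * t + a * t ^+ 2) ->
  'D_v f x0 = b /\ 'D_v ('D_v f) x0 <= 2 * a.
Proof.
move=> /(@near_along_line _ _ _ v) df d2f fle.
pose g (t : R) : R := f (x0 + t *: v) - (b * t + a * t ^+ 2).
pose dg (t : R) : R := 'D_v f (x0 + t *: v) - (b + 2 * a * t).
have g0 : g 0 = f x0 by rewrite /g scale0r addr0 mulr0 expr0n mulr0 addr0 subr0.
have dg0 : dg 0 = 'D_v f x0 - b by rewrite /dg scale0r addr0 mulr0 addr0.
have nearg : \forall t \near (0 : R),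
    is_derive (t : R) (1 : R) g (dg t) /\ g t <= g 0.
  near=> t; split; last first.
    rewrite g0 /g lerBlDr addrA; near: t; exact: fle.
  have /is_derive_along_line dft : derivable f (x0 + t *: v) v by near: t.
  have dq : is_derive (t : R) (1 : R) (b \*: (@id R) + a \*: ((@id R) ^+ 2))
      (b + 2 * a * t).
    by apply: is_derive_eq; rewrite /GRing.scale/=; ring.
  exact: (is_deriveB dft dq).
have /nbhs_ballP[r /= r0 rP] := nearg.
have {}rP (t : R) : `|t| < r -> is_derive t 1 g (dg t) /\ g t <= g 0.
  by move=> tr; apply: rP; rewrite /ball/= sub0r normrN.
have dfx0 : 'D_v f x0 = b.
  have [] := @derive1_at_max R g (- r) r 0.
  - by rewrite ge0_cp// ltW.
  - by move=> t; rewrite in_itv/= -ltr_norml => /rP[/@ex_derive].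
  - by rewrite in_itv/= oppr_lt0 r0.
  - by move=> t; rewrite in_itv/= -ltr_norml => /rP[].
  - move=> _; have [[_ ->] _] := rP 0 ltac:(by rewrite normr0).
    by rewrite dg0 => /eqP; rewrite subr_eq0 => /eqP.
split => //; rewrite leNgt; apply/negP => d2gt.
pose D := 'D_v ('D_v f) x0.
have : (fun h => h^-1 *: (('D_v f \o shift x0) (h *: v) - 'D_v f x0))
    @ 0^' --> D.
  exact: d2f.
move=> /cvgrPdist_lt /(_ (D - 2 * a)); rewrite subr_gt0 => /(_ d2gt).
move=> [/= d d0 dP].
pose s := Num.min r d / 2.
have s0 : 0 < s by rewrite divr_gt0// lt_min r0.
have sr : s < r.
  by rewrite ltr_pdivrMr// gt_min; apply/orP; left; lra.
have sd : s < d.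
  by rewrite ltr_pdivrMr// gt_min; apply/orP; right; lra.
have [||c] := @MVT R g dg 0 s s0.
- move=> t; rewrite in_itv/= => /andP[t0 ts].
  by have [] := rP t ltac:(by rewrite gtr0_norm// (lt_trans ts)).
- apply: derivable_within_continuous => t; rewrite in_itv/= => /andP[t0 ts].
  by have [/@ex_derive] := rP t ltac:(by rewrite ger0_norm// (le_lt_trans ts)).
rewrite in_itv/= => /andP[c0 cs] gE.
have : 0 < dg c.
  have := dP c; rewrite /= sub0r normrN gtr0_norm// (lt_trans cs sd) gt_eqF//.
  move=> /(_ isT isT)/(le_lt_trans (ler_norm _)).
  rewrite /= dfx0 ltrD2l ltrN2 /GRing.scale/= [c^-1 * _]mulrC ltr_pdivlMr// /dg.
  by rewrite (addrC _ x0); lra.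
have [_ gs] := rP s ltac:(by rewrite gtr0_norm).
move=> dgc; have : 0 < dg c * (s - 0) by rewrite subr0 mulr_gt0.
by rewrite -gE subr_gt0 ltNge gs.
Unshelve. all: by end_near. Qed.

Lemma second_derivative_test_below (R : realType) (V : normedModType R)
    (f : V -> R) (x0 v : V) (b a : R) :
  (\forall x \near x0, derivable f x v) ->
  derivable ('D_v f) x0 v ->
  (\forall t \near (0 : R), f x0 + b * t + a * t ^+ 2 <= f (x0 + t *: v)) ->
  'D_v f x0 = b /\ 2 * a <= 'D_v ('D_v f) x0.
Proof.
move=> df d2f fge.
have dfx0 : derivable f x0 v by exact: nbhs_singleton df.
have dN : \forall x \near x0, ('D_v (- f)) x = (- 'D_v f) x.
  by near=> x; apply: deriveN; near: x.
have [|||Nb Na] := @second_derivative_test _ _ (- f) x0 v (- b) (- a).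
- by near=> x; apply: derivableN; near: x.
- apply: near_eq_derivable (derivableN d2f).
  by near do apply/esym.
- near=> t; have -> y : (- f) y = - f y by [].
  rewrite !mulNr -!opprD lerN2; near: t; exact: fge.
split; first by apply: oppr_inj; rewrite -deriveN.
rewrite -lerN2 -mulrN; apply: le_trans Na.
by rewrite (near_eq_derive _ dN) deriveN.
Unshelve. all: by end_near. Qed.

Lemma Ck_derivable (R : realType) (V : normedModType R) (U : set V)
    (f : V -> R) (k : nat) (x v : V) : Ck k.+1 U f -> U x -> derivable f x v.
Proof. by move=> /(_ [::] isT) /= [_ /(_ isT v x)]. Qed.

Lemma quadratic_on_axis (R : realType) (n : nat) (x0 p : 'rV[R]_n) (a t : R)
    (i : 'I_n) (x := x0 + t *: delta_mx 0 i) :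
  dotv p (x - x0) + a * dotv (x - x0) (x - x0) = p 0 i * t + a * t ^+ 2.
Proof.
rewrite /x addrAC subrr add0r.
by rewrite dotvC !dotvZl !(dotvC (delta_mx 0 i)) !dotv_delta !mxE !eqxx /=;
  ring.
Qed.

(** The one-dimensional test applied along every axis: the gradient is read off
    coordinate by coordinate and the Laplacian is a sum of n second
    derivatives. *)
Lemma quadratic_touching_above (R : realType) (n : nat) (U : set 'rV[R]_n)
    (f : 'rV[R]_n -> R) (x0 p : 'rV[R]_n) (a : R) :
  open U -> Ck 2 U f -> U x0 ->
  (\forall x \near x0,
     f x <= f x0 + dotv p (x - x0) + a * dotv (x - x0) (x - x0)) ->
  grad f x0 = p /\ laplacian f x0 <= 2 * a * n%:R.
Proof.
move=> oU Cf Ux0 fle.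
have nU : \forall x \near x0, U x by exact: open_nbhs_nbhs.
have test i : 'D_(delta_mx 0 i) f x0 = p 0 i /\
    'D_(delta_mx 0 i) ('D_(delta_mx 0 i) f) x0 <= 2 * a.
  apply: second_derivative_test.
  - by near=> x; apply: (Ck_derivable Cf); near: x.
  - by have /= [_ /(_ isT)] := Cf [:: delta_mx 0 i] isT; apply.
  - have := near_along_line (delta_mx 0 i) fle; apply: filterS => t.
    by rewrite /= -!(addrA (f x0)) quadratic_on_axis.
split; first by apply/rowP => i; rewrite mxE; case: (test i).
apply: (le_trans (ler_sum _ (fun i _ => (test i).2))).
by rewrite sumr_const card_ord mulr_natr.
Unshelve. all: by end_near. Qed.

Lemma quadratic_touching_below (R : realType) (n : nat) (U : set 'rV[R]_n)
    (f : 'rV[R]_n -> R) (x0 p : 'rV[R]_n) (a : R) :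
  open U -> Ck 2 U f -> U x0 ->
  (\forall x \near x0,
     f x0 + dotv p (x - x0) + a * dotv (x - x0) (x - x0) <= f x) ->
  grad f x0 = p /\ 2 * a * n%:R <= laplacian f x0.
Proof.
move=> oU Cf Ux0 fge.
have nU : \forall x \near x0, U x by exact: open_nbhs_nbhs.
have test i : 'D_(delta_mx 0 i) f x0 = p 0 i /\
    2 * a <= 'D_(delta_mx 0 i) ('D_(delta_mx 0 i) f) x0.
  apply: second_derivative_test_below.
  - by near=> x; apply: (Ck_derivable Cf); near: x.
  - by have /= [_ /(_ isT)] := Cf [:: delta_mx 0 i] isT; apply.
  - have := near_along_line (delta_mx 0 i) fge; apply: filterS => t.
    by rewrite /= -!(addrA (f x0)) quadratic_on_axis.
split; first by apply/rowP => i; rewrite mxE; case: (test i).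
apply: le_trans (ler_sum _ (fun i _ => (test i).2)).
by rewrite sumr_const card_ord mulr_natr.
Unshelve. all: by end_near. Qed.

(** * Boundary charts *)

Lemma between_dist_le (R : realType) (a b z c r : R) :
  Num.min a b <= z <= Num.max a b -> `|a - c| <= r -> `|b - c| <= r ->
  `|z - c| <= r.
Proof.
rewrite ge_min le_max !ler_norml.
by move=> /andP[/orP[] ? /orP[] ?] /andP[? ?] /andP[? ?];
  apply/andP; split; lra.
Qed.

Lemma between_dist_lt (R : realType) (a b z c r : R) :
  Num.min a b <= z <= Num.max a b -> `|a - c| < r -> `|b - c| < r ->
  `|z - c| < r.
Proof.
move=> abz ac bc; apply: (@le_lt_trans _ _ (Num.max `|a - c| `|b - c|)).
  by apply: between_dist_le abz _ _; rewrite le_max lexx ?orbT.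
by rewrite gt_max ac bc.
Qed.

Lemma between_lt_mul (R : realType) (a b z c sg : R) :
  sg = 1 \/ sg = -1 -> Num.min a b <= z <= Num.max a b ->
  c < sg * a -> c < sg * b -> c < sg * z.
Proof.
rewrite ge_min le_max.
by case=> -> /andP[/orP[] ? /orP[] ?] ? ?; lra.
Qed.

Lemma box_in_ball (R : realType) (n : nat) (a b c z : 'rV[R]_n) (r : R) :
  `|a - c| < r -> `|b - c| < r -> inbox a b z -> `|z - c| < r.
Proof.
move=> ar br abz; apply: norm_row_lt => [|j]; first exact: le_lt_trans ar.
rewrite row_subE; apply: (between_dist_lt (abz j)); rewrite -row_subE.
  exact: le_lt_trans (norm_coord_le _ j) ar.
exact: le_lt_trans (norm_coord_le _ j) br.
Qed.

Lemma Ck1_locally_lipschitz (R : realType) (m : nat) (g : 'rV[R]_m -> R)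
    (c : 'rV[R]_m) : Ck 1 setT g ->
  exists L r, [/\ 0 <= L, 0 < r & forall a b, `|a - c| < r -> `|b - c| < r ->
    `|g b - g a| <= L * `|b - a|].
Proof.
move=> Cg.
have [M M0 nM] : exists2 M, 0 <= M & \forall x \near c, forall j : 'I_m,
    `|'D_(delta_mx 0 j) g x| <= M.
  pose M := \sum_(j < m) (`|'D_(delta_mx 0 j) g c| + 1).
  exists M; first by apply: sumr_ge0 => j _; rewrite addr_ge0.
  suff: forall j : 'I_m, \forall x \near c, `|'D_(delta_mx 0 j) g x| <= M.
    by move/filter_forall; apply.
  move=> j.
  have [/(_ c I) /= + _] := Cg [:: delta_mx 0 j] isT.
  move=> /cvgrPdist_lt /(_ 1 ltr01); apply: filterS => x dx.
  apply: (@le_trans _ _ (`|'D_(delta_mx 0 j) g c| + 1)).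
    by rewrite -lerBlDl; apply: le_trans (ltW dx); rewrite distrC lerB_dist.
  rewrite /M (bigD1 j)//= lerDl; apply: sumr_ge0 => k _; exact: addr_ge0.
have /nbhs_ballP[r /= r0 rM] := nM.
exists (m%:R * M), r; split => //; first by rewrite mulr_ge0.
move=> a b ar br; apply: increment_in_box => z /(box_in_ball ar br) zr j.
split; first exact: (Ck_derivable Cg).
by apply: rM; rewrite -ball_normE /ball_/= distrC.
Qed.

(** Here h is the graph function of a chart, read on the whole of R^n and
    constant along the axis i of the chart; sg is the orientation of the
    axis. *)
Definition lipschitz_chart (R : realType) (n : nat) (U : set 'rV[R]_n)
    (x0 : 'rV[R]_n) (r L sg : R) (i : 'I_n) (h : 'rV[R]_n -> R) : Prop :=
  [/\ forall x, `|x - x0| < r -> (U x <-> h x < sg * x 0 i),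
      forall x y, `|x - x0| < r -> `|y - x0| < r ->
        `|h y - h x| <= L * `|y - x| &
      forall x t, h (x + t *: delta_mx 0 i) = h x].

Lemma smooth_boundary_chart (R : realType) (n : nat) (U : set 'rV[R]_n)
    (x0 : 'rV[R]_n) : smooth_boundary U -> boundary U x0 ->
  exists r L sg i h, [/\ 0 < r, 0 <= L, sg = 1 \/ sg = -1 &
    lipschitz_chart U x0 r L sg i h].
Proof.
move=> sU /sU[r [i [s [g [r0 Cg UE]]]]].
have [L [r' [L0 r'0 gL]]] := Ck1_locally_lipschitz (col' i x0) (Cg 1%N).
have col'_le (x y : 'rV[R]_n) : `|col' i y - col' i x| <= `|y - x|.
  apply: norm_row_le => // j; rewrite !mxE.
  by have := norm_coord_le (y - x) (lift i j); rewrite !mxE.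
exists (Num.min r r'), L, ((-1) ^+ s), i, (fun x => g (col' i x)); split => //.
- by rewrite lt_min r0.
- by case: s {UE} => /=; [right; rewrite expr1|left; rewrite expr0].
split => [x|x y|x t].
- rewrite lt_min => /andP[xr _].
  have xb : ball x0 r x by rewrite -ball_normE /ball_/= distrC.
  split=> [Ux|gx].
    by have : (U `&` ball x0 r) x by []; rewrite UE => -[].
  have : ([set x | g (col' i x) < (-1) ^+ s * x 0 i] `&` ball x0 r) x by [].
  by rewrite -UE => -[].
- rewrite !lt_min => /andP[_ xr] /andP[_ yr].
  apply: le_trans (gL _ _ (le_lt_trans (col'_le _ _) xr)
                          (le_lt_trans (col'_le _ _) yr)) _.
  by rewrite ler_wpM2l.
- congr g; apply/rowP => j; rewrite !mxE.
  by rewrite eq_sym (negPf (neq_lift i j)) andbF mulr0 addr0.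
Qed.

(** As h does not depend on the i-th coordinate, moving z along the axis to the
    height of x shows that only the other coordinates matter. *)
Lemma chart_lipschitz_off_axis (R : realType) (n : nat) (U : set 'rV[R]_n)
    (x0 x z : 'rV[R]_n) (r L sg d : R) (i : 'I_n) (h : 'rV[R]_n -> R) :
  lipschitz_chart U x0 r L sg i h -> 0 <= L -> 0 <= d -> `|x - x0| + d < r ->
  (forall j, j != i -> `|z 0 j - x 0 j| <= d) -> `|h z - h x| <= L * d.
Proof.
move=> [_ hL hi] L0 d0 xr zx.
rewrite -(hi z (x 0 i - z 0 i)); set z' := z + _.
have z'x : `|z' - x| <= d.
  apply: norm_row_le => // j; have := zx j.
  rewrite /z' ![(_ - x) _ _]mxE [(- x) _ _]mxE axis_entry.
  case: (eqVneq j i) => [-> _|_];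
    first by rewrite [z 0 i + _]addrC subrK subrr normr0.
  by apply.
apply: le_trans (hL _ _ _ _) _; [lra | | exact: ler_wpM2l].
have := ler_normD (z' - x) (x - x0); rewrite subrKA; lra.
Qed.

(** * Going around obstructions inside the domain *)

(** The partial derivatives are only controlled at distance K |y - x| from x:
    this lets the estimate be applied to the remainder of a Taylor expansion,
    whose gradient is small near x only. *)
Definition detour_lipschitz (R : realType) (n : nat) (U : set 'rV[R]_n)
    (K : R) (x y : 'rV[R]_n) : Prop :=
  forall (f : 'rV[R]_n -> R) (B : R), 0 <= B ->
    (forall z, U z -> `|z - x| <= K * `|y - x| ->
       forall j, derivable f z (delta_mx 0 j) /\
         `|'D_(delta_mx 0 j) f z| <= B) ->
    `|f y - f x| <= K * B * `|y - x|.

Lemma detour_lipschitz_le (R : realType) (n : nat) (U : set 'rV[R]_n)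
    (K K' : R) (x y : 'rV[R]_n) : K <= K' ->
  detour_lipschitz U K x y -> detour_lipschitz U K' x y.
Proof.
move=> KK' D f B B0 fB; apply: (le_trans (D f B B0 _)).
  by move=> z Uz zx; apply: fB => //; rewrite (le_trans zx)// ler_wpM2r.
by rewrite ler_wpM2r// ler_wpM2r.
Qed.

Lemma detour_interior (R : realType) (n : nat) (U : set 'rV[R]_n)
    (x0 : 'rV[R]_n) : open U -> U x0 ->
  exists r K, [/\ 0 < r, 0 < K & forall x y,
    `|x - x0| < r -> `|y - x0| < r -> detour_lipschitz U K x y].
Proof.
move=> oU Ux0; have /nbhs_ballP[r /= r0 rU] := open_nbhs_nbhs (conj oU Ux0).
exists r, (n%:R + 1); split => [//||]; first by rewrite ltr_wpDl ?ler0n ?ltr01.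
move=> x y xr yr f B B0 fB; apply: (@le_trans _ _ (n%:R * B * `|y - x|)).
  apply: increment_in_box => z xyz; apply: fB.
    apply: rU; rewrite -ball_normE /ball_/= distrC.
    exact: box_in_ball xr yr xyz.
  have zx : `|z - x| <= `|y - x|.
    apply: norm_row_le => // j; rewrite row_subE.
    apply: (between_dist_le (xyz j)); rewrite -row_subE ?norm_coord_le//.
    by rewrite subrr mxE normr0.
  by rewrite (le_trans zx)// ler_peMl// lerDr.
by rewrite !ler_wpM2r// lerDl.
Qed.

(** With H = L |y - x|, the path goes from x to x1 by moving inwards by H along
    the axis of the chart, then from x1 to y1 at constant height, which clears
    the graph since the graph rises by at most H on the way, and then from y1
    to y along the axis.  Each leg is a box contained in U. *)
Lemma detour_boundary (R : realType) (n : nat) (U : set 'rV[R]_n)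
    (x0 : 'rV[R]_n) : smooth_boundary U -> boundary U x0 ->
  exists r K, [/\ 0 < r, 0 < K & forall x y, U x -> U y ->
    `|x - x0| < r -> `|y - x0| < r -> detour_lipschitz U K x y].
Proof.
move=> sU bx0.
have [r [L [sg [i [h [r0 L0 sgE ch]]]]]] := smooth_boundary_chart sU bx0.
have n0 : 0 <= n%:R :> R by [].
exists (r / (2 * L + 3)), (n%:R * (2 * L + 2) + (L + 1)).
have L3 : 0 < 2 * L + 3 by lra.
split; [by rewrite divr_gt0 | by nra |].
move=> x y Ux Uy; rewrite !ltr_pdivlMr// => xr yr.
set d := `|y - x|; move=> f B B0 fB.
have d0 : 0 <= d by exact: normr_ge0.
have dyx : d <= `|y - x0| + `|x - x0|.
  by rewrite /d -(subrKA x0) -[x0 - x]opprB; exact: ler_normB.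
have xd0 : 0 <= `|x - x0| by [].
have yd0 : 0 <= `|y - x0| by [].
have xr' : `|x - x0| + (L + 1) * d < r by nra.
have xr0 : `|x - x0| + d < r by nra.
have yr0 : `|y - x0| < r by nra.
have [chU _ _] := ch.
have xyj j : `|y 0 j - x 0 j| <= d.
  by have := norm_coord_le (y - x) j; rewrite !mxE.
have hx : h x < sg * x 0 i.
  by apply/chU => //; apply: le_lt_trans xr0; rewrite lerDl.
have hy : h y < sg * y 0 i by apply/chU.
have hyx : h y <= h x + L * d.
  have := chart_lipschitz_off_axis ch L0 d0 xr0 (fun j _ => xyj j).
  by rewrite ler_norml => /andP[_]; rewrite lerBlDl.
have sg2 : sg * sg = 1 by case: sgE => ->; ring.
pose H := L * d.
have H0 : 0 <= H by exact: mulr_ge0.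
pose x1 := x + (sg * H) *: delta_mx 0 i.
pose y1 := y + (x 0 i + sg * H - y 0 i) *: delta_mx 0 i.
have sgH : `|sg * H| = H.
  by rewrite normrM (ger0_norm H0); case: sgE => ->;
    rewrite ?normrN normr1 mul1r.
have Bz (z : 'rV[R]_n) : (forall j, j != i -> `|z 0 j - x 0 j| <= d) ->
    `|z 0 i - x 0 i| <= H + d -> h z < sg * z 0 i ->
    forall j, derivable f z (delta_mx 0 j) /\ `|'D_(delta_mx 0 j) f z| <= B.
  move=> zj zi hz.
  have zx : `|z - x| <= (L + 1) * d.
    apply: norm_row_le => [|j]; first by rewrite mulr_ge0// addr_ge0.
    rewrite !mxE mulrDl mul1r; case: (eqVneq j i) => [->//|/zj zjd].
    by rewrite (le_trans zjd)// lerDr.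
  apply: fB.
    apply/chU => //; apply: le_lt_trans xr'.
    by rewrite -(subrKA x) (le_trans (ler_normD _ _))// addrC lerD2l.
  by rewrite (le_trans zx)// ler_wpM2r// lerDr mulr_ge0// addr_ge0// mulr_ge0.
have hoff (z w : 'rV[R]_n) e : 0 <= e -> `|w - x0| + e < r ->
    (forall j, j != i -> `|z 0 j - w 0 j| <= e) -> h z <= h w + L * e.
  move=> e0 we zw; have := chart_lipschitz_off_axis ch L0 e0 we zw.
  by rewrite ler_norml => /andP[_]; rewrite lerBlDl.
have xyi : `|y 0 i - x 0 i| <= d := xyj i.
have x1E j : x1 0 j = if j == i then x 0 i + sg * H else x 0 j.
  exact: axis_entry.
have y1E j : y1 0 j = if j == i then x 0 i + sg * H else y 0 j.
  by rewrite /y1 axis_entry; case: ifP => // _; rewrite addrC subrK.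
have Hd j : `|x 0 j - x 0 j| <= H + d.
  by rewrite subrr normr0 addr_ge0.
have sgHi : `|x 0 i + sg * H - x 0 i| <= H + d.
  by rewrite addrAC subrr add0r sgH lerDl.
have hup : h x + L * d < sg * (x 0 i + sg * H).
  by rewrite mulrDr mulrA sg2 mul1r -/H ltrD2r.
have hx1 : h x < sg * (x 0 i + sg * H).
  by apply: le_lt_trans hup; rewrite lerDl.
have leg1 : `|f x1 - f x| <= n%:R * B * H.
  apply: le_trans (increment_in_box _) _ => [z xz|].
    have zj j : j != i -> z 0 j = x 0 j.
      move=> /negPf ji; have := xz j; rewrite x1E ji minxx maxxx => zx.
      by apply/eqP; rewrite eq_le andbC.
    have hz : h z <= h x.
      rewrite -[leRHS]addr0 -(mulr0 L); apply: hoff => // [|j ji].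
        by rewrite addr0 (le_lt_trans _ xr0)// lerDl.
      by rewrite zj// subrr normr0.
    have zi := xz i; rewrite x1E eqxx in zi.
    apply: Bz => [j ji||].
    - by rewrite zj// subrr normr0.
    - exact: between_dist_le zi (Hd i) sgHi.
    - exact: between_lt_mul sgE zi (le_lt_trans hz hx) (le_lt_trans hz hx1).
  rewrite ler_wpM2l ?mulr_ge0// norm_row_le// => j.
  rewrite row_subE x1E; case: (eqVneq j i) => [->|_].
    by rewrite addrAC subrr add0r sgH.
  by rewrite subrr normr0.
have leg2 : `|f y1 - f x1| <= n%:R * B * d.
  apply: le_trans (increment_in_box _) _ => [z xz|].
    have zj j : j != i -> `|z 0 j - x 0 j| <= d.
      move=> /negPf ji; have := xz j; rewrite x1E y1E ji => xzy.
      by apply: between_dist_le xzy _ (xyj j); rewrite subrr normr0.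
    have zi : z 0 i = x 0 i + sg * H.
      have := xz i; rewrite x1E y1E eqxx minxx maxxx => zx.
      by apply/eqP; rewrite eq_le andbC.
    have hz : h z <= h x + L * d by apply: hoff.
    by apply: Bz; rewrite ?zi//; exact: le_lt_trans hz hup.
  rewrite ler_wpM2l ?mulr_ge0// norm_row_le// => j.
  rewrite row_subE x1E y1E; case: (eqVneq j i) => [_|_]; last exact: xyj.
  by rewrite subrr normr0.
have leg3 : `|f y - f y1| <= n%:R * B * (H + d).
  apply: le_trans (increment_in_box _) _ => [z xz|].
    have zj j : j != i -> z 0 j = y 0 j.
      move=> /negPf ji; have := xz j; rewrite y1E ji minxx maxxx => zx.
      by apply/eqP; rewrite eq_le andbC.
    have hz : h z <= h y.
      rewrite -[leRHS]addr0 -(mulr0 L); apply: hoff => // [|j ji].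
        by rewrite addr0.
      by rewrite zj// subrr normr0.
    have zi := xz i; rewrite y1E eqxx in zi.
    apply: Bz => [j ji||].
    - by rewrite zj// xyj.
    - by apply: between_dist_le zi sgHi (le_trans xyi _); rewrite lerDr.
    - apply: (between_lt_mul sgE zi); last exact: le_lt_trans hz hy.
      exact: le_lt_trans hz (le_lt_trans hyx hup).
  rewrite ler_wpM2l ?mulr_ge0// norm_row_le ?addr_ge0// => j.
  rewrite row_subE y1E; case: (eqVneq j i) => [->|_]; last first.
    by rewrite subrr normr0 addr_ge0.
  rewrite -(subrKA (x 0 i)) (le_trans (ler_normD _ _))// addrC lerD//.
  by rewrite opprD addrA subrr add0r normrN sgH.
have -> : f y - f x = (f y - f y1) + (f y1 - f x1) + (f x1 - f x) by ring.
apply: le_trans (ler_normD _ _) _.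
apply: (le_trans (lerD (le_trans (ler_normD _ _) (lerD leg3 leg2)) leg1)).
rewrite /H -subr_ge0.
have -> : (n%:R * (2 * L + 2) + (L + 1)) * B * d
   - (n%:R * B * (L * d + d) + n%:R * B * d + n%:R * B * (L * d))
   = (L + 1) * B * d by ring.
by rewrite !mulr_ge0 ?addr_ge0.
Qed.

Lemma compact_closure (R : realType) (n : nat) (U : set 'rV[R]_n) :
  bounded_set U -> compact (closure U).
Proof.
move=> bU; apply: bounded_closed_compact; last exact: closed_closure.
have [M [Mr UM]] := bU; exists M; split => // M' MM' x clx.
have : closure [set y : 'rV[R]_n | `|y| <= M'] x.
  by apply: closure_subset clx => y Uy; exact: UM.
have cl : closed [set y : 'rV[R]_n | `|y| <= M'].
  apply: (@closed_comp _ _ (fun y : 'rV[R]_n => `|y|) [set r | r <= M']).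
    by move=> y _; exact: norm_continuous.
  exact: closed_le.
by move/(closure_id _).1: cl => <-.
Qed.

Lemma closure_cases (R : realType) (n : nat) (U : set 'rV[R]_n) x :
  open U -> closure U x -> U x \/ boundary U x.
Proof.
move=> oU clx; have [Ux|nUx] := pselect (U x); [by left|right].
by split => //; rewrite ((interior_id U).1 oU).
Qed.

Lemma boundary_notin (R : realType) (n : nat) (U : set 'rV[R]_n) x :
  open U -> boundary U x -> ~ U x.
Proof. by move=> oU [_]; rewrite ((interior_id U).1 oU). Qed.

Lemma near_norm_lt (R : realType) (n : nat) (x0 : 'rV[R]_n) (r : R) :
  0 < r -> \forall x \near x0, `|x - x0| < r.
Proof.
move=> r0; apply/nbhs_ballP; exists r => // x.
by rewrite -ball_normE /ball_/= distrC.
Qed.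

(** The constant 1 / K also serves as the scale below which the estimate holds,
    so that a single parameter K tending to infinity drives the covering
    argument. *)
Lemma uniform_detour (R : realType) (n : nat) (U : set 'rV[R]_n) :
  open U -> bounded_set U -> smooth_boundary U ->
  exists K : R, 0 < K /\ forall x y, U x -> U y -> K * `|y - x| < 1 ->
    detour_lipschitz U K x y.
Proof.
move=> oU bU sU.
have /compact_near_coveringP cov := compact_closure bU.
have := cov R +oo (fun K x => U x -> forall y, U y -> K * `|y - x| < 1 ->
    detour_lipschitz U K x y) _.
case=> [x0 clx0|K0 [K0r KP]].
  have [r [K0 [r0 K00 D]]] : exists r K, [/\ 0 < r, 0 < K & forall x y,
      U x -> U y -> `|x - x0| < r -> `|y - x0| < r -> detour_lipschitz U K x y].
    have [Ux0|bx0] := closure_cases oU clx0; last exact: detour_boundary.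
    have [r [K [r0 K0 D]]] := detour_interior oU Ux0.
    by exists r, K; split => // x y _ _; exact: D.
  near=> x K => /= Ux y Uy Kyx.
  have xr : `|x - x0| < r / 2 by near: x; apply: near_norm_lt; lra.
  apply: (detour_lipschitz_le (K := K0)); first by
    near: K; apply: nbhs_pinfty_ge; exact: num_real.
  have K1 : 2 / r < K by near: K; apply: nbhs_pinfty_gt; exact: num_real.
  apply: D => //.
  have yx : `|y - x| < r / 2.
    rewrite ltNge; apply/negP => ryx.
    suff : 1 <= K * `|y - x| by rewrite leNgt Kyx.
    have -> : 1 = 2 / r * (r / 2) :> R by field; rewrite gt_eqF.
    by apply: ler_pM => //; rewrite ?divr_ge0 ?ltW//.
  have := ler_normD (y - x) (x - x0); rewrite subrKA; lra.
exists (Num.max K0 0 + 1); have K0max : K0 < Num.max K0 0 + 1.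
  by rewrite ltr_pwDr// le_max lexx.
split; first by rewrite ltr_pwDr// le_max lexx orbT.
by move=> x y Ux Uy; apply: KP => //; exact: subset_closure.
Unshelve. all: by end_near. Qed.

(** In a chart, the point at depth t below the graph is at distance at least
    t / (L + 1) from U. *)
Lemma exterior_corkscrew (R : realType) (n : nat) (U : set 'rV[R]_n) :
  open U -> bounded_set U -> smooth_boundary U ->
  exists K : R, 0 < K /\ forall x t, boundary U x -> 0 < t -> K * t < 1 ->
    exists z, `|z - x| <= t /\ forall y, U y -> t <= K * `|y - z|.
Proof.
move=> oU bU sU.
have /compact_near_coveringP cov := compact_closure bU.
have := cov R +oo (fun K x => boundary U x -> forall t, 0 < t -> K * t < 1 ->
    exists z, `|z - x| <= t /\ forall y, U y -> t <= K * `|y - z|) _.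
case=> [x0 clx0|K0 [K0r KP]].
  have [Ux0|bx0] := closure_cases oU clx0.
    have nU : \forall x \near x0, U x by exact: open_nbhs_nbhs.
    near=> x K => /= bx; exfalso; apply: (boundary_notin oU bx).
    by near: x.
  have [r [L [sg [i [h [r0 L0 sgE ch]]]]]] := smooth_boundary_chart sU bx0.
  near=> x K => /= bx t t0 Kt.
  have xr : `|x - x0| < r / 4 by near: x; apply: near_norm_lt; lra.
  have KL : L + 1 <= K by near: K; apply: nbhs_pinfty_ge; exact: num_real.
  have Kr : 4 / r < K by near: K; apply: nbhs_pinfty_gt; exact: num_real.
  have tr : t < r / 4.
    rewrite ltNge; apply/negP => rt.
    suff : 1 <= K * t by rewrite leNgt Kt.
    have -> : 1 = 4 / r * (r / 4) :> R by field; rewrite gt_eqF.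
    by apply: ler_pM => //; rewrite ?divr_ge0 ?ltW//.
  exists (x + (- sg * t) *: delta_mx 0 i); set z := x + _.
  have zE j : z 0 j = if j == i then x 0 i - sg * t else x 0 j.
    by rewrite /z axis_entry mulNr.
  have sgt : `|sg * t| = t.
    by rewrite normrM (gtr0_norm t0); case: (sgE) => ->;
      rewrite ?normrN normr1 mul1r.
  have zx : `|z - x| <= t.
    rewrite norm_row_le ?ltW// => j; rewrite mxE [(- x) _ _]mxE zE.
    case: (eqVneq j i) => [->|_].
      by rewrite addrAC subrr add0r normrN sgt.
    by rewrite subrr normr0 ltW.
  split => // y Uy.
  set e := `|y - z|; have e0 : 0 <= e by exact: normr_ge0.
  have [yr|yr] := ltP `|y - x0| r; last first.
    have : `|y - x0| <= e + `|z - x| + `|x - x0|.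
      rewrite -(subrKA x) (le_trans (ler_normD _ _))// lerD2r.
      by rewrite -(subrKA z) ler_normD.
    nra.
  have [er|er] := ltP e (r / 2); last by nra.
  have [chU _ _] := ch.
  have hx : sg * x 0 i <= h x.
    rewrite leNgt; apply/negP => hlt; apply: (boundary_notin oU bx).
    by apply/chU => //; lra.
  have hy : h y < sg * y 0 i by apply/chU.
  have yz j : `|y 0 j - z 0 j| <= e.
    by have := norm_coord_le (y - z) j; rewrite !mxE.
  have : `|h y - h x| <= L * e.
    apply: (chart_lipschitz_off_axis ch) => //; first lra.
    by move=> j /negPf ji; have := yz j; rewrite zE ji.
  have : sg * y 0 i <= sg * x 0 i - t + e.
    have := yz i; rewrite zE eqxx ler_norml.
    by case: (sgE) => -> /andP[? ?]; lra.
  by rewrite ler_norml => ? /andP[? ?]; nra.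
exists (Num.max K0 0 + 1); have K0max : K0 < Num.max K0 0 + 1.
  by rewrite ltr_pwDr// le_max lexx.
split; first by rewrite ltr_pwDr// le_max lexx orbT.
by move=> x t bx; apply: KP => //; case: bx.
Unshelve. all: by end_near. Qed.

(** * Continuity on closed sets *)

Lemma within_continuousP (R : realType) (T : topologicalType) (K : set T)
    (f : T -> R) :
  {within K, continuous f} <->
  forall x e, K x -> 0 < e -> \forall y \near x, K y -> `|f y - f x| < e.
Proof.
split=> [/subspace_continuousP cf x e Kx e0|cf].
  have /cvgrPdist_lt/(_ e e0) := cf x Kx.
  by rewrite near_withinE; apply: filterS => y fy /fy; rewrite distrC.
apply/subspace_continuousP => x Kx; apply/cvgrPdist_lt => e e0.
by rewrite near_withinE; apply: filterS (cf x e Kx e0) => y fy /fy;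
  rewrite distrC.
Qed.

Lemma compact_continuous_bounded (R : realType) (T : topologicalType)
    (K : set T) (f : T -> R) : compact K -> {within K, continuous f} ->
  exists B, 0 <= B /\ forall x, K x -> `|f x| <= B.
Proof.
move=> cK /continuous_compact/(_ cK)/compact_bounded[M [Mr KM]].
exists (Num.max M 0 + 1); split; first by rewrite ler_wpDr// le_max lexx orbT.
move=> x Kx; apply: KM; last by exists x.
by rewrite ltr_pwDr// le_max lexx.
Qed.

Lemma compact_argmin (R : realType) (T : topologicalType) (K : set T)
    (f : T -> R) : K !=set0 -> compact K -> {within K, continuous f} ->
  exists x, K x /\ forall y, K y -> f x <= f y.
Proof.
move=> K0 cK cf; have [x + xmin] := compact_EVT_min K0 cK cf; rewrite inE => Kx.
by exists x; split => // y Ky; apply: xmin; rewrite inE.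
Qed.

Lemma compact_argmax (R : realType) (T : topologicalType) (K : set T)
    (f : T -> R) : K !=set0 -> compact K -> {within K, continuous f} ->
  exists x, K x /\ forall y, K y -> f y <= f x.
Proof.
move=> K0 cK cf; have [x + xmax] := compact_EVT_max K0 cK cf; rewrite inE => Kx.
by exists x; split => // y Ky; apply: xmax; rewrite inE.
Qed.

Lemma compact_uniformly_continuous (R : realType) (n : nat)
    (K : set 'rV[R]_n) (f : 'rV[R]_n -> R) (e : R) :
  compact K -> {within K, continuous f} -> 0 < e ->
  exists r, 0 < r /\
    forall x y, K x -> K y -> `|y - x| < r -> `|f y - f x| < e.
Proof.
move=> cK /within_continuousP cf e0.
have /compact_near_coveringP cov := cK.
have := cov R 0^'+ (fun r x => K x -> forall y, K y -> `|y - x| < r ->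
   `|f y - f x| < e) _.
case=> [x0 Kx0|r /= r0 rP].
  have /nbhs_ballP[d /= d0 dP] := cf x0 (e / 2) Kx0 ltac:(lra).
  near=> x r => /= Kx y Ky yx.
  have xd : `|x - x0| < d / 2 by near: x; apply: near_norm_lt; lra.
  have rd : r < d / 2 by near: r; apply: nbhs_right_lt; lra.
  have yd : `|y - x0| < d.
    by have := ler_normD (y - x) (x - x0); rewrite subrKA; lra.
  have fd z : K z -> `|z - x0| < d -> `|f z - f x0| < e / 2.
    by move=> Kz zd; apply: dP => //; rewrite -ball_normE /ball_/= distrC.
  have fx : `|f x - f x0| < e / 2 by apply: fd => //; lra.
  have fy := fd y Ky yd.
  by move: fx fy; rewrite !ltr_norml => /andP[? ?] /andP[? ?]; apply/andP;
    split; lra.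
exists (r / 2); split; first lra.
move=> x y Kx Ky yx; apply: (rP (r / 2)) => //=; last lra.
by rewrite sub0r normrN gtr0_norm; lra.
Unshelve. all: by end_near. Qed.

Lemma within_continuous_fst (R : realType) (T T' : topologicalType)
    (A : set T) (B : set T') (f : T -> R) : {within A, continuous f} ->
  {within A `*` B, continuous (fun z => f z.1)}.
Proof.
move=> /within_continuousP cf; apply/within_continuousP => -[x y] e [Ax _] e0.
exists ([set x' | A x' -> `|f x' - f x| < e], setT).
  by split; [exact: cf | exact: filterT].
by move=> [x' y'] /= [fx _] [Ax' _]; exact: fx.
Qed.

Lemma within_continuous_snd (R : realType) (T T' : topologicalType)
    (A : set T) (B : set T') (f : T' -> R) : {within B, continuous f} ->
  {within A `*` B, continuous (fun z => f z.2)}.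
Proof.
move=> /within_continuousP cf; apply/within_continuousP => -[x y] e [_ By] e0.
exists (setT, [set y' | B y' -> `|f y' - f y| < e]).
  by split; [exact: filterT | exact: cf].
by move=> [x' y'] /= [_ fy] [_ By']; exact: fy.
Qed.

Lemma closure_le (R : realType) (n : nat) (U : set 'rV[R]_n)
    (f g : 'rV[R]_n -> R) (x0 : 'rV[R]_n) :
  {within closure U, continuous f} -> {within closure U, continuous g} ->
  closure U x0 -> (\forall x \near x0, U x -> f x <= g x) -> f x0 <= g x0.
Proof.
move=> /within_continuousP cf /within_continuousP cg clx0 fg.
rewrite leNgt; apply/negP => gf.
pose e := (f x0 - g x0) / 2; have e0 : 0 < e by rewrite /e; lra.
have nb : \forall x \near x0, U x -> False.
  near=> x => Ux; have clx := subset_closure Ux.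
  have fx : `|f x - f x0| < e by move: clx; near: x; exact: cf.
  have gx : `|g x - g x0| < e by move: clx; near: x; exact: cg.
  have : f x <= g x by move: Ux; near: x.
  by move: fx gx; rewrite !ltr_norml /e => /andP[? ?] /andP[? ?]; lra.
by have [x [Ux /(_ Ux)]] := clx0 _ nb.
Unshelve. all: by end_near. Qed.

Lemma continuous_addf (R : realType) (T : topologicalType) (f g : T -> R) :
  continuous f -> continuous g -> continuous (fun x => f x + g x).
Proof. by move=> cf cg x; exact: (continuousD (cf x) (cg x)). Qed.

Lemma continuous_subf (R : realType) (T : topologicalType) (f g : T -> R) :
  continuous f -> continuous g -> continuous (fun x => f x - g x).
Proof. by move=> cf cg x; exact: (continuousB (cf x) (cg x)). Qed.

Lemma continuous_scalef (R : realType) (T : topologicalType) (k : R)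
    (f : T -> R) : continuous f -> continuous (fun x => k * f x).
Proof.
by move=> cf x; exact: (continuousM (@cst_continuous _ _ k x) (cf x)).
Qed.

Lemma continuous_dotv (R : realType) (n : nat) (T : topologicalType)
    (a b : T -> 'rV[R]_n) : continuous a -> continuous b ->
  continuous (fun x => dotv (a x) (b x)).
Proof.
move=> ca cb x; rewrite /dotv; apply: cvg_big => [|i _].
  exact: add_continuous.
apply: cvgM.
  exact: (cvg_comp _ _ (ca x) (@coord_continuous _ _ _ 0 i (a x))).
exact: (cvg_comp _ _ (cb x) (@coord_continuous _ _ _ 0 i (b x))).
Qed.

Lemma continuous_sub (R : realType) (n : nat) (c : 'rV[R]_n) :
  continuous (fun x : 'rV[R]_n => x - c).
Proof.
by move=> x; apply: continuousB => [|]; [exact: cvg_id | exact: cst_continuous].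
Qed.

Lemma continuous_dist (R : realType) (n : nat) (c : 'rV[R]_n) :
  continuous (fun x : 'rV[R]_n => `|x - c|).
Proof.
move=> x.
exact: (continuous_comp (@continuous_sub _ _ c x)
                        (@norm_continuous _ _ (x - c))).
Qed.

Lemma is_derive_dotv (R : realType) (n : nat) (q x v : 'rV[R]_n) :
  is_derive x v (dotv q) (dotv q v).
Proof.
have lin : (fun s : R => dotv q (x + s *: v)) =
    (fun s => dotv q x + s * dotv q v).
  by apply/funext => s; rewrite dotvC dotvDl dotvZl !(dotvC _ q).
have : is_derive (0 : R) (1 : R) (fun s : R => dotv q (x + s *: v)) (dotv q v).
  rewrite lin.
  have -> : (fun s => dotv q x + s * dotv q v) =
     cst (dotv q x) + (dotv q v) \*: (@id R).
    by apply/funext => s; rewrite /= mulrC.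
  by apply: is_derive_eq; rewrite add0r /GRing.scale/= mulr1.
move=> [d dE]; move: d dE; rewrite /derivable /derive quotient_along_line.
by rewrite scale0r addr0 => d dE; split.
Qed.

(** * Functions of class C1 up to the boundary *)

(** Close points are joined by a path inside U; for distant points the bound on
    f itself suffices. *)
Lemma uniformly_lipschitz (R : realType) (n : nat) (U : set 'rV[R]_n) :
  open U -> bounded_set U -> smooth_boundary U ->
  exists K : R, 0 < K /\ forall (f : 'rV[R]_n -> R) (B : R), 0 <= B ->
    (forall x, U x -> `|f x| <= B) ->
    (forall x, U x -> forall j, derivable f x (delta_mx 0 j) /\
       `|'D_(delta_mx 0 j) f x| <= B) ->
    forall x y, U x -> U y -> `|f y - f x| <= K * B * `|y - x|.
Proof.
move=> oU bU sU; have [K [K0 D]] := uniform_detour oU bU sU.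
exists (2 * K); split=> [|f B B0 fB dfB x y Ux Uy]; first lra.
have [yx|yx] := ltP (K * `|y - x|) 1.
  apply: (le_trans (D x y Ux Uy yx f B B0 (fun z Uz _ => dfB z Uz))).
  by rewrite ler_wpM2r// ler_wpM2r//; lra.
have := ler_normB (f y) (f x); have := fB x Ux; have := fB y Uy.
have -> : 2 * K * B * `|y - x| = 2 * B * (K * `|y - x|) by ring.
nra.
Qed.

Lemma continuous_gradient (R : realType) (n : nat) (U : set 'rV[R]_n)
    (f : 'rV[R]_n -> R) : open U -> Ck_bar 1 U f ->
  [/\ forall j, {within closure U, continuous (fun x => grad_bar U f x 0 j)},
      forall x, U x -> grad_bar U f x = grad f x &
      forall x v, U x -> derivable f x v].
Proof.
move=> oU [Cf _ ext].
have /choice[g gP] (j : 'I_n) : exists g : 'rV[R]_n -> R,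
    {within closure U, continuous g} /\
    forall x, U x -> g x = 'D_(delta_mx 0 j) f x.
  by have [g cg gE] := ext [:: delta_mx 0 j] isT; exists g.
have gbar x j : closure U x -> grad_bar U f x 0 j = g j x.
  move=> clx; rewrite mxE; apply/cvg_lim => //.
  have [/within_continuousP cg gE] := gP j.
  apply/cvgrPdist_lt => e e0; rewrite near_withinE.
  apply: filterS (cg x e clx e0) => y gy Uy; rewrite mxE -gE//.
  by rewrite distrC gy//; exact: subset_closure.
split=> [j|x Ux|x v Ux].
- have [/within_continuousP cg _] := gP j.
  apply/within_continuousP => x e clx e0.
  apply: filterS (cg x e clx e0) => y gy cly.
  by rewrite !gbar// gy.
- apply/rowP => j; rewrite gbar; last exact: subset_closure.
  by rewrite mxE (gP j).2.
- exact: Ck_derivable Cf Ux.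
Qed.

Lemma C1_bounded (R : realType) (n : nat) (U : set 'rV[R]_n)
    (f : 'rV[R]_n -> R) : open U -> bounded_set U -> Ck_bar 1 U f ->
  exists B, [/\ 0 <= B, forall x, U x -> `|f x| <= B &
    forall x, U x -> forall j, derivable f x (delta_mx 0 j) /\
      `|'D_(delta_mx 0 j) f x| <= B].
Proof.
move=> oU bU Cf; have [_ cf _] := Cf.
have [cg gE df] := continuous_gradient oU Cf.
have cK := compact_closure bU.
have [B0 [B00 fB]] := compact_continuous_bounded cK cf.
have /choice[B BP] j := compact_continuous_bounded cK (cg j).
exists (B0 + \sum_j B j); split => [|x Ux|x Ux j].
- by rewrite addr_ge0// sumr_ge0// => j _; case: (BP j).
- have clx := subset_closure Ux.
  rewrite (le_trans (fB x clx))// lerDl sumr_ge0// => j _.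
  by case: (BP j).
split; first exact: df.
have := (BP j).2 x (subset_closure Ux); rewrite gE// mxE => /le_trans; apply.
rewrite (bigD1 j)//= addrCA lerDl addr_ge0// sumr_ge0// => k _.
by case: (BP k).
Qed.

Lemma C1_lipschitz (R : realType) (n : nat) (U : set 'rV[R]_n)
    (f : 'rV[R]_n -> R) :
  open U -> bounded_set U -> smooth_boundary U -> Ck_bar 1 U f ->
  exists L, 0 <= L /\ forall x y, closure U x -> closure U y ->
    `|f y - f x| <= L * `|y - x|.
Proof.
move=> oU bU sU Cf; have [B [B0 fB dfB]] := C1_bounded oU bU Cf.
have [_ cf _] := Cf.
have [K [K0 KP]] := uniformly_lipschitz oU bU sU.
exists (K * B); split; first by rewrite mulr_ge0// ltW.
have lipU x y : U x -> U y -> f y <= f x + K * B * `|y - x|.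
  move=> Ux Uy.
  have := KP f B B0 fB dfB x y Ux Uy.
  by rewrite ler_norml; lra.
have cr (a b : R) (c : 'rV[R]_n) :
  {within closure U, continuous (fun x => a + b * `|x - c|)}.
  apply: continuous_subspaceT; apply: continuous_addf.
    by move=> x; exact: cst_continuous.
  by apply: continuous_scalef; exact: continuous_dist.
have lip1 x y : U x -> closure U y -> f y <= f x + K * B * `|y - x|.
  move=> Ux cly; apply: (closure_le cf (cr _ _ _) cly).
  by near=> z => Uz; exact: lipU.
have lip2 x y : closure U x -> closure U y -> f y <= f x + K * B * `|y - x|.
  move=> clx cly; rewrite -lerBlDr.
  have c' : {within closure U, continuous (fun z => f y - K * B * `|y - z|)}.
    have -> : (fun z => f y - K * B * `|y - z|) =
        (fun z => f y + (- (K * B)) * `|z - y|).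
      by apply/funext => z; rewrite mulNr distrC.
    exact: cr.
  apply: (closure_le c' cf clx).
  by near=> z => Uz; rewrite lerBlDr; exact: lip1.
move=> x y clx cly; have := lip2 x y clx cly; have := lip2 y x cly clx.
by rewrite [`|x - y|]distrC ler_norml => ? ?; apply/andP; split; lra.
Unshelve. all: by end_near. Qed.

(** Subtracting the linear part leaves a function whose gradient is small near
    x, by uniform continuity of the gradient, and paths inside U of length
    comparable to |y - x| then bound its increment. *)
Lemma C1_taylor (R : realType) (n : nat) (U : set 'rV[R]_n)
    (f : 'rV[R]_n -> R) (e : R) :
  open U -> bounded_set U -> smooth_boundary U -> Ck_bar 1 U f -> 0 < e ->
  exists r, 0 < r /\ forall x y, U x -> `|y - x| < r ->
    (closure U y -> f x + dotv (grad f x) (y - x) - e * `|y - x| <= f y) /\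
      (U y -> `|grad f y - grad f x| < e).
Proof.
move=> oU bU sU Cf e0; have [_ cf _] := Cf.
have [cg gE df] := continuous_gradient oU Cf.
have cK := compact_closure bU.
have uc (d : R) : 0 < d -> exists r, 0 < r /\ forall x y, U x -> U y ->
    `|y - x| < r -> forall j, `|grad f y 0 j - grad f x 0 j| < d.
  move=> d0; have /choice[r rP] j := compact_uniformly_continuous cK (cg j) d0.
  exists (\big[Num.min/1]_j r j); split.
    by apply: lt_bigmin => // j _; case: (rP j).
  move=> x y Ux Uy yx j.
  rewrite -!gE//; apply: (rP j).2; [exact: subset_closure..|].
  apply: lt_le_trans yx _; exact: bigmin_le_cond.
have [K [K0 KP]] := uniform_detour oU bU sU.
have [r1 [r10 r1P]] := uc e e0.
have [r2 [r20 r2P]] := uc (e / K) (divr_gt0 e0 K0).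
have iK0 : 0 < K^-1 by rewrite invr_gt0.
pose r := Num.min r1 (Num.min K^-1 (K^-1 * r2)).
exists r; split; first by rewrite !lt_min r10 iK0 mulr_gt0.
move=> x y Ux yx; split; last first.
  move=> Uy; apply: norm_row_lt => // j.
  rewrite row_subE; apply: r1P => //.
  by apply: lt_le_trans yx _; rewrite ge_min lexx.
move=> cly.
have cl : {within closure U, continuous (fun y =>
  f x + dotv (grad f x) (y - x) - e * `|y - x|)}.
  apply: continuous_subspaceT; apply: continuous_subf.
    apply: continuous_addf; first by move=> z; exact: cst_continuous.
    by apply: continuous_dotv;
      [move=> ?; exact: cst_continuous | exact: continuous_sub].
  by apply: continuous_scalef; exact: continuous_dist.
apply: (closure_le cl cf cly).
have nr : \forall z \near y, `|z - x| < r.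
  have := near_norm_lt y (r := r - `|y - x|); rewrite subr_gt0 => /(_ yx).
  apply: filterS => z zy.
  have := ler_normD (z - y) (y - x); rewrite subrKA; lra.
near=> z => Uz.
have zx : `|z - x| < r by near: z.
have zx2 : K * `|z - x| < 1.
  by rewrite mulrC -ltr_pdivlMr// div1r (lt_le_trans zx)// !ge_min lexx orbT.
have zx3 : K * `|z - x| < r2.
  by rewrite mulrC -ltr_pdivlMr// mulrC (lt_le_trans zx)// !ge_min lexx !orbT.
pose h w := f w - dotv (grad f x) w.
have dh w j : U w -> is_derive w (delta_mx 0 j) h
    ('D_(delta_mx 0 j) f w - grad f x 0 j).
  move=> Uw; have /derivableP dfw := df w (delta_mx 0 j) Uw.
  rewrite -(dotv_delta (grad f x) j).
  exact: is_deriveB dfw (is_derive_dotv _ _ _).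
have := KP x z Ux Uz zx2 h (e / K) (ltW (divr_gt0 e0 K0)).
have -> : K * (e / K) = e by field; rewrite gt_eqF.
case/(_ _)/ler_normlP => [w Uw wx j|].
  have [dhw dhwE] := dh w j Uw; split => //.
  rewrite dhwE; have := r2P x w Ux Uw (le_lt_trans wx zx3) j.
  by rewrite [grad f w 0 j]mxE => /ltW.
rewrite /h.
have -> : dotv (grad f x) (z - x) = dotv (grad f x) z - dotv (grad f x) x.
  by rewrite dotvC dotvDl -[- x]scaleN1r dotvZl mulN1r !(dotvC (grad f x)).
lra.
Unshelve. all: by end_near. Qed.

Lemma closure_setXT (T T' : topologicalType) (U : set T) (x : T) (p : T') :
  closure U x -> closure (U `*` [set: T']) (x, p).
Proof.
move=> clx N [[A B] /= [Ax Bp] ABN]; have [y [Uy Ay]] := clx _ Ax.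
exists (y, p); split; first by split.
by apply: ABN; split => //=; exact: nbhs_singleton.
Qed.

(** * Consequences of the hypotheses on the Hamiltonian *)

(** The strict inequality holds on a compact set and H is continuous there, so
    it has a margin, which persists for gradients close to that of Phi. *)
Lemma strict_subsolution_margin (R : realType) (n : nat) (U : set 'rV[R]_n)
    (Phi : 'rV[R]_n -> R) (H : 'rV[R]_n -> 'rV[R]_n -> R) :
  open U -> bounded_set U -> Ck_bar 1 U Phi ->
  {within closure (U `*` [set: 'rV[R]_n]),
    continuous (fun z : 'rV[R]_n * 'rV[R]_n => H z.1 z.2)} ->
  (forall x, closure U x -> Phi x + H x (grad_bar U Phi x) < 0) ->
  exists k, 0 < k /\ forall y p, U y -> `|p - grad Phi y| <= k ->
    Phi y + H y p < - k.
Proof.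
move=> oU bU CPhi /within_continuousP cH sub;
  have [_ /within_continuousP cPhi _] := CPhi.
have [cg gE _] := continuous_gradient oU CPhi.
have /compact_near_coveringP cov := compact_closure bU.
have := cov R 0^'+ (fun k y => U y -> forall p, `|p - grad Phi y| <= k ->
    Phi y + H y p < - k) _.
case=> [x0 clx0|k0 /= k00 kP]; last first.
  exists (k0 / 2); split; first lra.
  move=> y p Uy; apply: (kP (k0 / 2)) => //=; last exact: subset_closure.
    by rewrite sub0r normrN gtr0_norm; lra.
  lra.
set q0 := grad_bar U Phi x0; have sub0 : Phi x0 + H x0 q0 < 0 := sub x0 clx0.
pose m := - (Phi x0 + H x0 q0); have m0 : 0 < m by rewrite oppr_gt0.
have m3 : 0 < m / 3 by lra.
have [[/= A B] [Ax0 Bq0] ABH] := cH (x0, q0) (m / 3) (closure_setXT clx0) m3.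
have /nbhs_ballP[d /= d0 dB] := Bq0.
have d2 : 0 < d / 2 by lra.
have gnear : \forall y \near x0, U y -> forall j : 'I_n,
    `|grad_bar U Phi y 0 j - q0 0 j| < d / 2.
  suff : forall j : 'I_n, \forall y \near x0, U y ->
      `|grad_bar U Phi y 0 j - q0 0 j| < d / 2.
    by move=> /filter_forall; apply: filterS => y yj Uy j; exact: yj.
  move=> j; have /within_continuousP cgj := cg j.
  by apply: filterS (cgj x0 _ clx0 d2) => y gy Uy; apply: gy;
    exact: subset_closure.
near=> y k => /= Uy p pk.
have cly := subset_closure Uy.
have k1 : k < d / 2 by near: k; exact: nbhs_right_lt.
have k2 : k < m / 3 by near: k; exact: nbhs_right_lt.
have Phiy : `|Phi y - Phi x0| < m / 3.
  by move: cly; near: y; exact: cPhi.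
have gyj : U y -> forall j : 'I_n, `|grad_bar U Phi y 0 j - q0 0 j| < d / 2.
  by near: y; exact: gnear.
have gy : `|grad_bar U Phi y - q0| < d / 2.
  by apply: norm_row_lt => // j; rewrite row_subE; exact: gyj.
have Ay : A y by near: y; exact: Ax0.
have Hy : `|H y p - H x0 q0| < m / 3.
  apply: (ABH (y, p)); last exact: closure_setXT.
  split => //=; apply: dB; rewrite -ball_normE /ball_/= distrC.
  have := ler_normD (p - grad Phi y) (grad Phi y - q0).
  by rewrite subrKA -{2}gE//; lra.
move: Phiy Hy; rewrite !ltr_norml /m => /andP[? ?] /andP[? ?].
rewrite /m in k2; lra.
Unshelve. all: by end_near. Qed.

Lemma hamiltonian_C1_bounded (R : realType) (n : nat) (U : set 'rV[R]_n)
    (H : 'rV[R]_n -> 'rV[R]_n -> R) (L : R) :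
  bounded_set U ->
  Ck_bar 1 (U `*` [set: 'rV[R]_n]) (fun z : 'rV[R]_n * 'rV[R]_n => H z.1 z.2) ->
  exists B, [/\ 0 <= B,
    forall x p, U x -> `|p| <= L -> `|H x p| <= B &
    forall x p, U x -> `|p| <= L -> forall j,
      derivable (fun y => H y p) x (delta_mx 0 j) /\
      `|'D_(delta_mx 0 j) (fun y => H y p) x| <= B].
Proof.
move=> bU [CH cH ext].
pose K := closure U `*` [set p : 'rV[R]_n | `|p| <= L].
have cK : compact K.
  apply: compact_setX; first exact: compact_closure.
  apply: bounded_closed_compact; last first.
    apply: (@closed_comp _ _ (fun y : 'rV[R]_n => `|y|) [set r | r <= L]).
      by move=> y _; exact: norm_continuous.
    exact: closed_le.
  by exists L; split; [exact: num_real | move=> M LM p /le_trans; apply;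
    exact: ltW].
have Ksub : K `<=` closure (U `*` [set: 'rV[R]_n]).
  by move=> [x p] [clx _]; exact: closure_setXT.
have [B0 [B00 HB]] := compact_continuous_bounded cK
  (continuous_subspaceW Ksub cH).
have /choice[B BP] (j : 'I_n) : exists B, 0 <= B /\
    forall x p, U x -> `|p| <= L ->
    derivable (fun y => H y p) x (delta_mx 0 j) /\
    `|'D_(delta_mx 0 j) (fun y => H y p) x| <= B.
  have [g cg gE] := ext [:: (delta_mx 0 j, 0)] isT.
  have [B [B1 gB]] := compact_continuous_bounded cK
    (continuous_subspaceW Ksub cg).
  exists B; split => // x p Ux pL.
  have Exp : (fun h : R => h^-1 *: (((fun z : 'rV[R]_n * 'rV[R]_n => H z.1 z.2)
        \o shift (x, p)) (h *: (delta_mx 0 j, 0)) - H x p)) =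
      (fun h : R => h^-1 *:
        (((fun y => H y p) \o shift x) (h *: delta_mx 0 j) - H x p)).
    by apply/funext => h /=; rewrite scaler0 add0r.
  have UXp : (U `*` [set: 'rV[R]_n]) (x, p) by [].
  have := Ck_derivable (v := (delta_mx 0 j, 0)) CH UXp.
  have := gB (x, p) (conj (subset_closure Ux) pL); rewrite (gE (x, p) UXp) /=.
  by rewrite /derive /derivable Exp.
exists (B0 + \sum_j B j); split => [|x p Ux pL|x p Ux pL j].
- by rewrite addr_ge0// sumr_ge0// => j _; case: (BP j).
- have := HB (x, p) (conj (subset_closure Ux) pL) => /le_trans; apply.
  by rewrite lerDl sumr_ge0// => j _; case: (BP j).
have [_ /(_ x p Ux pL)[dH dHB]] := BP j; split => //.
apply: (le_trans dHB).
rewrite (bigD1 j)//= addrCA lerDl addr_ge0// sumr_ge0// => k _.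
by case: (BP k).
Qed.

(** * Barriers *)

(** Let x0 minimise v - Phi, and suppose v(x0) < Phi(x0) - k n eps.  Consider
    Psi(x) = Phi(x0) + DPhi(x0).(x - x0) - a |x - x0|^2 with a = k / (4 n eps),
    on the points at distance at most n eps from x0.  By Taylor's formula,
    Phi - Psi is positive on the sphere of radius n eps and at least
    - k n eps / 64 everywhere; hence v - Psi, which is less than - k n eps at
    x0, has its minimum at an interior point y of U.  There DPsi is within k of
    DPhi(y) and eps Lap Psi = - k / 2, while v < Phi <= psi switches the penalty
    off: this contradicts the margin of Phi. *)
Lemma penalized_ge_subsolution (R : realType) (n : nat) (U : set 'rV[R]_n)
    (Phi psi : 'rV[R]_n -> R) (H : 'rV[R]_n -> 'rV[R]_n -> R) (gamma : R -> R)
    (k : R) :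
  (0 < n)%N -> open U -> bounded_set U -> smooth_boundary U ->
  Ck_bar 1 U Phi -> (forall x, closure U x -> Phi x <= psi x) ->
  (forall x, boundary U x -> Phi x = 0) ->
  (forall s, s <= 0 -> gamma s = 0) -> 0 < k ->
  (forall y p, U y -> `|p - grad Phi y| <= k -> Phi y + H y p < - k) ->
  exists e0, 0 < e0 /\ forall eps v, 0 < eps -> eps < e0 ->
    penalized_solution U H psi gamma eps v ->
    forall x, closure U x -> Phi x - k * n%:R * eps <= v x.
Proof.
move=> n0 oU bU sU CPhi Phipsi Phi0 gam0 k0 margin.
have k8 : 0 < k / 8 by lra.
have [r [r0 taylor]] := C1_taylor oU bU sU CPhi k8.
have N0 : 0 < n%:R :> R by rewrite ltr0n.
exists (r / n%:R); split; first exact: divr_gt0.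
move=> eps v eps0; rewrite ltr_pdivlMr// mulrC => Ner.
move=> [Cv pde v0] x1 clx1.
have [[_ cPhi _] [_ cv _]] := (CPhi, Cv 2%N).
have clU0 : closure U !=set0 by exists x1.
have cvPhi : {within closure U, continuous (fun x => v x - Phi x)}.
  exact: continuous_subf.
have [x0 [clx0 x0min]] := compact_argmin clU0 (compact_closure bU) cvPhi.
apply: (@le_trans _ _ (Phi x1 + (v x0 - Phi x0))); last first.
  by have := x0min x1 clx1; lra.
rewrite lerD2l; set m := v x0 - Phi x0; set e := n%:R * eps.
have e0 : 0 < e by exact: mulr_gt0.
rewrite -mulrA -/e leNgt; apply/negP => mlt.
have ke : 0 < k * e by exact: mulr_gt0.
have Ux0 : U x0.
  have [//|bx0] := closure_cases oU clx0.
  by move: mlt; rewrite /m v0// Phi0// subrr; lra.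
pose a := k / (4 * e).
have a0 : 0 < a by rewrite divr_gt0// mulr_gt0.
have ae : a * e = k / 4 by rewrite /a; field; rewrite gt_eqF.
pose q := grad Phi x0.
pose Psi x := Phi x0 + (dotv q (x - x0) + (- a) * dotv (x - x0) (x - x0)).
pose D := closure U `&` [set x | `|x - x0| <= e].
have Dx0 : D x0 by split => //=; rewrite subrr normr0 ltW.
have cPsi : continuous Psi.
  apply: continuous_addf; first by move=> x; exact: cst_continuous.
  apply: continuous_addf.
    by apply: continuous_dotv;
      [move=> ?; exact: cst_continuous | exact: continuous_sub].
  by apply: continuous_scalef; apply: continuous_dotv; exact: continuous_sub.
have cD : compact D.
  apply: (subclosed_compact _ (compact_closure bU)); last by move=> x [].
  apply: closedI; first exact: closed_closure.
  apply: (@closed_comp _ _ (fun y : 'rV[R]_n => `|y - x0|) [set r | r <= e]).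
    by move=> y _; exact: continuous_dist.
  exact: closed_le.
have cvPsi : {within D, continuous (fun x => v x - Psi x)}.
  apply: continuous_subf; last exact: continuous_subspaceT.
  by apply: continuous_subspaceW cv => x [].
have [y [[cly /= ye] ymin]] := compact_argmin (ex_intro _ x0 Dx0) cD cvPsi.
have Psix0 : Psi x0 = Phi x0.
  by rewrite /Psi subrr -(scale0r x0) dotvC !dotvZl !mul0r mulr0 !addr0.
have wm : v y - Psi y <= m by have := ymin x0 Dx0; rewrite Psix0.
set s := `|y - x0| in ye *.
have s0 : 0 <= s by exact: normr_ge0.
have PhiPsi : a * s ^+ 2 - k / 8 * s <= Phi y - Psi y.
  have [/(_ cly) + _] := taylor x0 y Ux0 (le_lt_trans ye Ner).
  have := sqr_norm_le_dotv (y - x0); rewrite -/s -/q /Psi => dge.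
  have : a * s ^+ 2 <= a * dotv (y - x0) (y - x0) by rewrite ler_wpM2l// ltW.
  lra.
(* Completing the square, with a e = k / 4. *)
have quad : - (k * e) < a * s ^+ 2 - k / 8 * s.
  have : 0 <= a * (s - e / 4) ^+ 2 by rewrite mulr_ge0 ?sqr_ge0// ltW.
  have -> : a * (s - e / 4) ^+ 2 =
      a * s ^+ 2 - (a * e) * s / 2 + (a * e) * e / 16 by field.
  by rewrite ae; lra.
have vPhi : v y < Phi y by lra.
have Uy : U y.
  have [//|by_] := closure_cases oU cly.
  by move: vPhi; rewrite v0// Phi0// ltxx.
have se : s < e.
  rewrite lt_neqAle ye andbT; apply/eqP => sE.
  have : v x0 - Phi x0 <= v y - Phi y by exact: x0min.
  have : 0 < a * s ^+ 2 - k / 8 * s.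
    by rewrite sE expr2 mulrA ae; lra.
  rewrite -/m; lra.
pose p := q + (2 * - a) *: (y - x0).
have [||gy ly] := @quadratic_touching_below R n U v y p (- a) oU _ Uy.
- by have [] := Cv 2%N.
- have nD : \forall x \near y, D x.
    have : \forall x \near y, `|x - y| < e - s.
      by apply: near_norm_lt; rewrite subr_gt0.
    have : \forall x \near y, U x by exact: open_nbhs_nbhs.
    apply: filterS2 => x Ux xy; split; first exact: subset_closure.
    have := ler_normD (x - y) (y - x0); rewrite subrKA /= -/s; lra.
  apply: filterS nD => x /ymin; rewrite /Psi.
  by rewrite (quadratic_recenter q x0 x y (- a)) -/p; lra.
have gam : gamma ((v y - psi y) / eps) = 0.
  apply: gam0; rewrite pmulr_lle0 ?invr_gt0// subr_le0.
  exact: le_trans (ltW vPhi) (Phipsi _ cly).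
have pk : `|p - grad Phi y| <= k.
  have -> : p - grad Phi y = (q - grad Phi y) + (2 * - a) *: (y - x0)
    by rewrite addrAC.
  apply: le_trans (ler_normD _ _) _; rewrite normrZ -/s.
  have [_ /(_ Uy)] := taylor x0 y Ux0 (le_lt_trans ye Ner).
  rewrite distrC -/q => qy.
  have -> : `|2 * - a| = 2 * a by rewrite mulrN normrN gtr0_norm// mulr_gt0.
  have : a * s <= a * e by rewrite ler_wpM2l// ltW.
  by rewrite ae; lra.
have := margin y p Uy pk; have := pde y Uy; rewrite gam gy.
have : eps * (2 * - a * n%:R) <= eps * laplacian v y by rewrite ler_wpM2l// ltW.
have -> : eps * (2 * - a * n%:R) = - (2 * (a * e)) by rewrite /e; ring.
by rewrite ae; lra.
Qed.

(** With z the exterior point at distance at most t from xh provided by the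
    corkscrew property, |y - z| >= t / K for y in U.  The barrier is
    w(y) = (M / t) (|y - z|^2 - t^2 / K^2) with M = K (|r0| + 1).
    It is nonnegative on the closure of U, and its gradient has norm at least
    2 M / K > r0, so H(y, Dw) > 1, while eps Lap w = 2 n M eps / t.  The choice
    t = 4 n M s makes this at most s / 2 and the coefficient 2 M / t of
    |x - xh|^2 at most 1 / (2 s), which is what the penalty of the doubling
    argument can absorb. *)
Lemma penalized_boundary_growth (R : realType) (n : nat) (U : set 'rV[R]_n)
    (psi : 'rV[R]_n -> R) (H : 'rV[R]_n -> 'rV[R]_n -> R) (gamma : R -> R)
    (r0 : R) :
  (0 < n)%N -> open U -> bounded_set U -> smooth_boundary U ->
  (forall s, 0 <= gamma s) ->
  (forall x p, U x -> r0 < enorm p -> 1 < H x p) ->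
  exists s0 C, [/\ 0 < s0, 0 < C & forall eps s v,
    0 < eps -> eps <= s ^+ 2 -> 0 < s -> s < s0 ->
    penalized_solution U H psi gamma eps v ->
    forall x xh, closure U x -> boundary U xh ->
      v x <= dotv (x - xh) (x - xh) / (2 * s) + C * s].
Proof.
move=> n0 oU bU sU gam0 coer.
have N1 : 1 <= n%:R :> R by rewrite ler1n.
have N0 : 0 < n%:R :> R by rewrite ltr0n.
have [K [K0 cork]] := exterior_corkscrew oU bU sU.
pose M := K * (`|r0| + 1).
have M0 : 0 < M by rewrite mulr_gt0// ltr_wpDl.
have NM0 : 0 < 4 * n%:R * M by rewrite !mulr_gt0.
exists (Num.min 1 (K * (4 * n%:R * M))^-1), (8 * n%:R ^+ 2 * M ^+ 2); split.
- by rewrite lt_min ltr01 invr_gt0 mulr_gt0.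
- by rewrite !mulr_gt0// exprn_gt0.
move=> eps s v eps0 epss s0;
  rewrite lt_min => /andP[s1 sK] [Cv pde v0] x xh clx bxh.
pose t := 4 * n%:R * M * s.
have t0 : 0 < t by rewrite mulr_gt0.
have Kt : K * t < 1.
  by rewrite /t mulrA mulrC -ltr_pdivlMr ?mulr_gt0// div1r.
have [z [zxh zfar]] := cork xh t bxh t0 Kt.
pose a := M / t.
have a0 : 0 < a by exact: divr_gt0.
pose b := (t / K) ^+ 2.
pose w y := a * dotv (y - z) (y - z) - a * b.
have cw : continuous w.
  apply: continuous_subf; last by move=> ?; exact: cst_continuous.
  by apply: continuous_scalef; apply: continuous_dotv; exact: continuous_sub.
have far y : closure U y -> t <= K * `|y - z|.
  move=> cly.
  have c1 : {within closure U, continuous (fun=> t : R)}.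
    by apply: continuous_subspaceT => ?; exact: cst_continuous.
  have c2 : {within closure U, continuous (fun y => K * `|y - z|)}.
    by apply: continuous_subspaceT; apply: continuous_scalef;
      exact: continuous_dist.
  by apply: (closure_le c1 c2 cly); near=> y' => Uy'; exact: zfar.
have w_ge0 y : closure U y -> 0 <= w y.
  move=> /far ty; rewrite /w -mulrBr mulr_ge0 ?(ltW a0)// subr_ge0.
  apply: le_trans (sqr_norm_le_dotv _);
    rewrite /b lerXn2r ?nnegrE ?divr_ge0 ?(ltW t0) ?(ltW K0)//.
  by rewrite ler_pdivrMr// mulrC.
have vw : v x <= w x.
  have [_ cv _] := Cv 2%N.
  have cvw : {within closure U, continuous (fun y => v y - w y)}.
    by apply: continuous_subf; last exact: continuous_subspaceT.
  have [y [cly ymax]] := compact_argmax (ex_intro _ x clx) (compact_closure bU)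
    cvw.
  rewrite -subr_le0; apply: (le_trans (ymax x clx)).
  rewrite leNgt; apply/negP => vwy.
  have wy := w_ge0 y cly.
  have Uy : U y.
    have [//|by_] := closure_cases oU cly.
    by move: vwy; rewrite v0//; lra.
  pose p := (2 * a) *: (y - z).
  have [||gy ly] := @quadratic_touching_above R n U v y (0 + p) a oU _ Uy.
  - by have [] := Cv 2%N.
  - have nU : \forall x' \near y, U x' by exact: open_nbhs_nbhs.
    apply: filterS nU => x' Ux'; have := ymax x' (subset_closure Ux');
      rewrite /w.
    have := quadratic_recenter 0 z x' y a.
    rewrite -/p -(scale0r y) !(dotvZl 0) !mul0r !add0r; lra.
  rewrite add0r in gy.
  have pr : r0 < enorm p.
    apply: lt_le_trans (norm_le_enorm p).
    have a2 : 0 < 2 * a by rewrite mulr_gt0.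
    rewrite normrZ (gtr0_norm a2).
    have : 2 * a * t <= 2 * a * (K * `|y - z|)
      by rewrite ler_wpM2l ?far ?(ltW a2).
    have -> : 2 * a * t = K * (2 * (`|r0| + 1)).
      by rewrite /a /M; field; rewrite gt_eqF.
    have -> : 2 * a * (K * `|y - z|) = K * (2 * a * `|y - z|) by ring.
    rewrite ler_pM2l// => rle; apply: lt_le_trans rle.
    by have := ler_norm r0; have := normr_ge0 r0; lra.
  have := coer y p Uy pr; have := pde y Uy; rewrite gy.
  have := gam0 ((v y - psi y) / eps).
  have : eps * laplacian v y <= 1.
    apply: (@le_trans _ _ (eps * (2 * a * n%:R)));
      first by rewrite ler_wpM2l// ltW.
    have -> : 2 * a * n%:R = (2 * s)^-1.
      by rewrite /a /t; field; rewrite !gt_eqF.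
    rewrite ler_pdivrMr ?mulr_gt0// mul1r; apply: (le_trans epss).
    by rewrite expr2; nra.
  lra.
apply: (le_trans vw).
have zz : dotv (xh - z) (xh - z) <= n%:R * t ^+ 2.
  apply: le_trans (dotv_le_sqr_norm _) _.
  by rewrite ler_wpM2l// lerXn2r ?nnegrE ?(ltW t0)// distrC.
have := dotvDD_le (x - xh) (xh - z); rewrite subrKA => xz.
have d0 := dotv_ge0 (x - xh).
set d := dotv (x - xh) (x - xh) in xz d0 *.
have : a * dotv (x - z) (x - z) <= a * (2 * d + 2 * (n%:R * t ^+ 2)).
  by rewrite ler_wpM2l ?(ltW a0)//; lra.
have -> : a * (2 * d + 2 * (n%:R * t ^+ 2)) =
    d / (2 * s) / n%:R + 8 * n%:R ^+ 2 * M ^+ 2 * s.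
  by rewrite /a /t; field; rewrite !gt_eqF.
have : d / (2 * s) / n%:R <= d / (2 * s).
  by rewrite ler_pdivrMr// ler_peMr// divr_ge0// ltW// mulr_gt0.
have : 0 <= a * b by rewrite mulr_ge0 ?(ltW a0)// sqr_ge0.
by rewrite /w; lra.
Unshelve. all: by end_near. Qed.

(** * Doubling the variables *)

(** The estimate at a maximum point (x0, y0) of v(x) - w(y) - |x - y|^2 / (2 s),
    for given constants.  The hypothesis on L comes from coercivity and bounds
    the common gradient p; the one on Gam inverts gamma.  If x0 is on the
    boundary, the lower barrier Phi - C1 s for w is used and the penalty absorbs
    the term LPhi |x0 - y0|; if y0 is, the growth of v is absorbed by the
    penalty. *)
Lemma doubling_estimate (R : realType) (n : nat) (U : set 'rV[R]_n)
    (psi Phi : 'rV[R]_n -> R) (H : 'rV[R]_n -> 'rV[R]_n -> R) (gamma : R -> R)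
    (s eps del B0 C1 C2 LPhi Lpsi LH L Gam : R) (v w : 'rV[R]_n -> R) :
  open U -> bounded_set U ->
  (forall r, 0 <= gamma r) -> (forall r, r <= 0 -> gamma r = 0) ->
  0 < s -> 0 < eps -> eps <= s ^+ 2 -> eps <= s ->
  0 < del -> del <= s ^+ 2 -> del <= s ->
  penalized_solution U H psi gamma eps v ->
  penalized_solution U H psi gamma del w ->
  0 <= C1 -> 0 <= C2 -> 0 <= LPhi -> 0 <= Lpsi -> 0 <= LH -> 0 <= L ->
    0 <= Gam ->
  (forall x, boundary U x -> Phi x = 0) ->
  (forall x y, closure U x -> closure U y ->
    `|Phi y - Phi x| <= LPhi * `|y - x|) ->
  (forall x y, closure U x -> closure U y ->
    `|psi y - psi x| <= Lpsi * `|y - x|) ->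
  (forall x, closure U x -> Phi x - C1 * s <= w x) ->
  (forall x, U x -> - B0 <= v x) ->
  (forall x xh, closure U x -> boundary U xh ->
     v x <= dotv (x - xh) (x - xh) / (2 * s) + C2 * s) ->
  (forall x p, U x -> H x p <= B0 + n%:R * s -> `|p| <= L) ->
  (forall x y p, U x -> U y -> `|p| <= L -> H y p - H x p <= LH * `|y - x|) ->
  (forall x p r, U x -> `|p| <= L -> gamma r <= B0 + n%:R * s - H x p ->
    r <= Gam) ->
  forall x, U x -> v x - w x <=
    (LPhi ^+ 2 + C1 + C2 + 2 * n%:R + LH * L + Gam + Lpsi * L) * s.
Proof.
move=> oU bU gam_ge0 gam0 s0 eps0 epss epss1 del0 dels dels1.
move=> [Cv pdev v0] [Cw pdew w0].
move=> C10 C20 LPhi0 Lpsi0 LH0 L0 Gam0 Phi0 lipPhi lippsi wPhi vB bdry coer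
  lipH gamB x1 Ux1.
have N0 : 0 <= n%:R :> R by [].
set C := (X in _ <= X * s).
have [[_ cv _] [_ cw _]] := (Cv 2%N, Cw 2%N).
have [[Cv2 _ _] [Cw2 _ _]] := (Cv 2%N, Cw 2%N).
pose K := closure U `*` closure U.
have cK : compact K by apply: compact_setX; exact: compact_closure.
pose a := (2 * s)^-1.
have a0 : 0 < a by rewrite invr_gt0 mulr_gt0.
pose F (z : 'rV[R]_n * 'rV[R]_n) :=
  v z.1 - w z.2 - a * dotv (z.1 - z.2) (z.1 - z.2).
have cF : {within K, continuous F}.
  apply: continuous_subf.
    apply: continuous_subf; first exact: within_continuous_fst.
    exact: within_continuous_snd.
  apply: continuous_subspaceT; apply: continuous_scalef.
  have csub : continuous (fun z : 'rV[R]_n * 'rV[R]_n => z.1 - z.2).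
    by move=> z; apply: continuousB => [|]; [exact: cvg_fst | exact: cvg_snd].
  exact: continuous_dotv.
have clx1 := subset_closure Ux1.
have Kx1 : K (x1, x1) by [].
have [[x0 y0] [[/= clx0 cly0] Fmax]] := compact_argmax (ex_intro _ _ Kx1) cK cF.
have dot0 : dotv (x1 - x1) (x1 - x1) = 0.
  by rewrite subrr -(scale0r x1) dotvZl mul0r.
have -> : v x1 - w x1 = F (x1, x1) by rewrite /F /= dot0 mulr0 subr0.
apply: (le_trans (Fmax _ Kx1)); rewrite /F /=.
set d2 := dotv (x0 - y0) (x0 - y0).
have d20 : 0 <= d2 := dotv_ge0 _.
have ad20 : 0 <= a * d2 by rewrite mulr_ge0// ltW.
pose d := `|x0 - y0|; have d0 : 0 <= d by exact: normr_ge0.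
have dd2 : d ^+ 2 <= d2 by exact: sqr_norm_le_dotv.
have as2 : 2 * a * s = 1 by rewrite /a; field; rewrite gt_eqF.
have terms : [/\ 0 <= LPhi ^+ 2 * s, 0 <= C1 * s, 0 <= C2 * s &
   [/\ 0 <= n%:R * s, 0 <= LH * L * s, 0 <= Gam * s & 0 <= Lpsi * L * s]].
  by split; last split; rewrite ?mulr_ge0 ?sqr_ge0// ltW.
case: terms => t1 t2 t3 [t4 t5 t6 t7].
have CE : C * s = LPhi ^+ 2 * s + C1 * s + C2 * s + 2 * (n%:R * s) + LH * L * s
   + Gam * s + Lpsi * L * s by rewrite /C; ring.
have [Ux0|bx0] := closure_cases oU clx0; last first.
  rewrite v0//; have := wPhi y0 cly0.
  have := lipPhi x0 y0 clx0 cly0;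
    rewrite (Phi0 _ bx0) subr0 distrC -/d ler_norml => /andP[Phiy _].
  have : LPhi * d - a * d ^+ 2 <= LPhi ^+ 2 * s.
    (* The penalty absorbs the linear term: complete the square. *)
    have : 0 <= a * (d - s * LPhi) ^+ 2 by rewrite mulr_ge0 ?sqr_ge0// ltW.
    have -> : a * (d - s * LPhi) ^+ 2 =
      a * d ^+ 2 - (2 * a * s) * LPhi * d + (2 * a * s) * (LPhi ^+ 2 * s) / 2
        by field.
    by rewrite as2; lra.
  have : a * d ^+ 2 <= a * d2 by rewrite ler_wpM2l// ltW.
  lra.
have [Uy0|by0] := closure_cases oU cly0; last first.
  by rewrite w0//; have := bdry x0 y0 clx0 by0; rewrite -/d2 [d2 / _]mulrC -/a;
    lra.
pose p := (2 * a) *: (x0 - y0).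
have [gx lx] : grad v x0 = 0 + p /\ laplacian v x0 <= 2 * a * n%:R.
  apply: (quadratic_touching_above oU Cv2 Ux0).
  have nU : \forall x \near x0, U x by exact: open_nbhs_nbhs.
  apply: filterS nU => x Ux.
  have := Fmax (x, y0) (conj (subset_closure Ux) cly0); rewrite /F /=.
  have := quadratic_recenter 0 y0 x x0 a.
  by rewrite -/p -(scale0r y0) !(dotvZl 0) !mul0r !add0r -/d2; lra.
have [gy ly] : grad w y0 = 0 + (2 * - a) *: (y0 - x0) /\
    2 * - a * n%:R <= laplacian w y0.
  apply: (quadratic_touching_below oU Cw2 Uy0).
  have nU : \forall y \near y0, U y by exact: open_nbhs_nbhs.
  apply: filterS nU => y Uy.
  have := Fmax (x0, y) (conj clx0 (subset_closure Uy)); rewrite /F /=.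
  have := quadratic_recenter 0 x0 y y0 (- a).
  rewrite (dotv_distC x0 y) (dotv_distC x0 y0).
  by rewrite -(scale0r y0) !(dotvZl 0) !mul0r !add0r; lra.
have gyp : grad w y0 = p by rewrite gy add0r mulrN scaleNr -scalerN opprB.
rewrite add0r in gx.
have sn : s ^+ 2 * (2 * a * n%:R) = n%:R * s.
  have -> : s ^+ 2 * (2 * a * n%:R) = (2 * a * s) * (n%:R * s) by ring.
  by rewrite as2 mul1r.
have epsl : eps * laplacian v x0 <= n%:R * s.
  apply: (@le_trans _ _ (eps * (2 * a * n%:R)));
    first by rewrite ler_wpM2l// ltW.
  apply: (@le_trans _ _ (s ^+ 2 * (2 * a * n%:R))); last by rewrite sn.
  by rewrite ler_wpM2r// !mulr_ge0// ltW.
have dell : - (n%:R * s) <= del * laplacian w y0.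
  apply: (@le_trans _ _ (del * (2 * - a * n%:R)));
    last by rewrite ler_wpM2l// ltW.
  rewrite mulrN mulNr mulrN lerN2.
  apply: (@le_trans _ _ (s ^+ 2 * (2 * a * n%:R))); last by rewrite sn.
  by rewrite ler_wpM2r// !mulr_ge0// ltW.
have := pdev x0 Ux0; rewrite gx; set g1 := gamma _ => Ev.
have := pdew y0 Uy0; rewrite gyp; set g2 := gamma _ => Ew.
have {}Ev : v x0 + H x0 p + g1 <= n%:R * s by rewrite Ev.
have {}Ew : - (n%:R * s) <= w y0 + H y0 p + g2 by rewrite Ew.
clear lx ly epsl dell gx gy gyp sn.
have g10 : 0 <= g1 by exact: gam_ge0.
have vB0 := vB x0 Ux0.
have pL : `|p| <= L.
  by apply: (coer x0) => //; move: Ev g10 vB0; clear -R; lra.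
have dL : d <= L * s.
  have -> : d = `|p| * s.
    by rewrite /p normrZ gtr0_norm ?mulr_gt0// mulrAC as2 mul1r.
  by rewrite ler_wpM2r// ltW.
have vpsi : v x0 <= psi x0 + Gam * s.
  have : (v x0 - psi x0) / eps <= Gam.
    apply: (gamB x0 p) => //; rewrite -/g1.
    by move: Ev vB0; clear -R; lra.
  rewrite ler_pdivrMr// => h; have : Gam * eps <= Gam * s by rewrite ler_wpM2l.
  by move: h; clear -R; lra.
have psid : psi x0 - psi y0 <= Lpsi * L * s.
  have := lippsi y0 x0 cly0 clx0; rewrite -/d ler_norml => /andP[_ psile].
  apply: (le_trans psile); rewrite -mulrA ler_wpM2l//.
have Hd : H y0 p - H x0 p <= LH * L * s.
  apply: le_trans (lipH x0 y0 p Ux0 Uy0 pL) _.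
  by rewrite distrC -/d -mulrA ler_wpM2l.
(* Where w is above the obstacle, v is compared with the obstacle; elsewhere
   the penalty g2 of w vanishes and the equations are subtracted. *)
have [wpsi|wpsi] := leP (w y0) (psi y0); last first.
  by move: vpsi psid wpsi t1 t2 t3 t4 t5 ad20; rewrite CE; clear -R; lra.
have g20 : g2 = 0.
  by apply: gam0; rewrite pmulr_lle0 ?invr_gt0// subr_le0.
move: Ev Ew g10 Hd t1 t2 t3 t6 t7 ad20; rewrite CE g20; clear -R; lra.
Qed.

Lemma superlinear_coercive (R : realType) (n : nat) (A : set 'rV[R]_n)
    (H : 'rV[R]_n -> 'rV[R]_n -> R) (T : R) :
  tends_to_pinfty_unif A (fun x p => H x p / enorm p) ->
  exists r, 0 <= r /\ forall x p, A x -> r < enorm p -> T < H x p.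
Proof.
move=> /(_ 1)[r rP]; exists (Num.max `|r| `|T|); split.
  by rewrite le_max normr_ge0.
move=> x p Ax; rewrite gt_max => /andP[rp Tp].
have p0 : 0 < enorm p by apply: le_lt_trans Tp.
have := rP x p Ax (le_lt_trans (ler_norm r) rp).
rewrite ltr_pdivlMr// mul1r; apply: lt_trans.
exact: le_lt_trans (ler_norm T) Tp.
Qed.

Lemma penalization_bounded_argument (R : realType) (gamma : R -> R) (T : R) :
  penalization gamma ->
  exists Gam, 0 <= Gam /\ forall r, gamma r <= T -> r <= Gam.
Proof.
move=> [_ _ _ _ /cvgryPgt/(_ T)[M [_ MP]]].
exists (Num.max M 0); split; first by rewrite le_max lexx orbT.
move=> r; apply: contraTT; rewrite -!ltNge gt_max => /andP[Mr _].
exact: MP.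
Qed.

(** All constants are fixed before eps, del and s: B0 bounds - v from above, L
    bounds the gradient at the maximum point, B bounds H and D_x H for
    gradients of norm at most L, and Gam is such that gamma > B0 + n + B beyond
    it. *)
Lemma penalized_solutions_close (R : realType) (n : nat) (U : set 'rV[R]_n)
    (psi : 'rV[R]_n -> R) (H : 'rV[R]_n -> 'rV[R]_n -> R) (gamma : R -> R)
    (Phi : 'rV[R]_n -> R) :
  (0 < n)%N -> open U -> bounded_set U -> smooth_boundary U ->
  Ck_bar 1 U psi ->
  Ck_bar 1 (U `*` [set: 'rV[R]_n])
    (fun z : 'rV[R]_n * 'rV[R]_n => H z.1 z.2) ->
  penalization gamma ->
  tends_to_pinfty_unif (closure U) (fun x p => H x p / enorm p) ->
  Ck_bar 1 U Phi -> (forall x, closure U x -> Phi x <= psi x) ->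
  (forall x, boundary U x -> Phi x = 0) ->
  (forall x, closure U x -> Phi x + H x (grad_bar U Phi x) < 0) ->
  exists s0 C, [/\ 0 < s0, 0 < C & forall s eps del v w,
    0 < s -> s < s0 -> 0 < eps -> eps <= s ^+ 2 -> 0 < del -> del <= s ^+ 2 ->
    penalized_solution U H psi gamma eps v ->
    penalized_solution U H psi gamma del w ->
    forall x, U x -> v x - w x <= C * s].
Proof.
move=> n0 oU bU sU Cpsi CH pen Hinf CPhi Phipsi Phi0 sub.
have [_ gam_ge0 gam0 _ _] := pen.
have [_ cH _] := CH.
have N0 : 0 < n%:R :> R by rewrite ltr0n.
have [k [k0 margin]] := strict_subsolution_margin oU bU CPhi cH sub.
have [e1 [e10 lower]] :=
  penalized_ge_subsolution n0 oU bU sU CPhi Phipsi Phi0 gam0 k0 margin.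
have [r0 [_ coer1]] := superlinear_coercive 1 Hinf.
have [s0 [C2 [s00 C20 upper]]] :=
  penalized_boundary_growth psi n0 oU bU sU gam_ge0
  (fun x p Ux => coer1 x p (subset_closure Ux)).
have [LPhi [LPhi0 lipPhi]] := C1_lipschitz oU bU sU CPhi.
have [Lpsi [Lpsi0 lippsi]] := C1_lipschitz oU bU sU Cpsi.
have [BPhi [BPhi0 PhiB _]] := C1_bounded oU bU CPhi.
pose C1 := k * n%:R.
have C10 : 0 <= C1 by rewrite mulr_ge0// ltW.
pose B0 := BPhi + C1.
have [L [L0 coerL]] := superlinear_coercive (B0 + n%:R) Hinf.
have [B [B_ge0 HB dHB]] := hamiltonian_C1_bounded L bU CH.
have [K [K0 KP]] := uniformly_lipschitz oU bU sU.
have [Gam [Gam0 GamP]] := penalization_bounded_argument (B0 + n%:R + B) pen.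
exists (Num.min 1 (Num.min s0 e1)),
  (LPhi ^+ 2 + C1 + C2 + 2 * n%:R + (K * B) * L + Gam + Lpsi * L).
have KB0 : 0 <= K * B by rewrite mulr_ge0// ltW.
split.
- by rewrite !lt_min ltr01 s00.
- have := mulr_ge0 KB0 L0; have := mulr_ge0 Lpsi0 L0; have := sqr_ge0 LPhi; lra.
move=> s eps del v w sp;
  rewrite !lt_min => /and3P[s1 ss0 se1] eps0 epss del0 dels solv solw.
have s2 : s ^+ 2 <= s by rewrite expr2 ler_piMr// ltW.
have epss1 : eps <= s := le_trans epss s2.
have dels1 : del <= s := le_trans dels s2.
have ns : n%:R * s <= n%:R by rewrite ler_piMr// ltW.
apply: (@doubling_estimate _ _ U psi Phi H gamma s eps del B0 C1 C2 LPhi Lpsi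
  (K * B) L Gam) => //.
- exact: ltW.
- move=> x clx; apply:
    le_trans (lower del w del0 (le_lt_trans dels1 se1) solw x clx).
  by rewrite lerD2l lerN2 ler_wpM2l.
- move=> x Ux.
  have := lower eps v eps0 (le_lt_trans epss1 se1) solv x (subset_closure Ux).
  apply: le_trans; have := PhiB x Ux; rewrite ler_norml => /andP[PhiBx _].
  have : C1 * eps <= C1 by rewrite ler_piMr// (le_trans epss1)// ltW.
  rewrite /B0 -/C1; lra.
- move=> x xh clx bxh;
    exact: (upper eps s v eps0 epss sp ss0 solv x xh clx bxh).
- move=> x p Ux Hxp; apply: (le_trans (norm_le_enorm p)).
  rewrite leNgt; apply/negP => /(coerL x p (subset_closure Ux)); lra.
- move=> x y p Ux Uy pL; apply: le_trans (ler_norm _) _.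
  by apply: (KP (fun z => H z p)) => // z Uz; [exact: HB | exact: dHB].
- move=> x p r Ux pL gr; apply: GamP; apply: (le_trans gr).
  by have := HB x p Ux pL; rewrite ler_norml => /andP[? _]; lra.
Qed.

Unset Implicit Arguments.

Theorem theorem1p1 (R : realType) (n : nat) (U : set 'rV[R]_n)
    (psi : 'rV[R]_n -> R) (H : 'rV[R]_n -> 'rV[R]_n -> R) (gamma : R -> R)
    (eps1 : R) (ueps : R -> 'rV[R]_n -> R) (u : 'rV[R]_n -> R) :
  (2 <= n)%N ->
  smooth_bounded_domain U ->
  Cinf_bar U psi ->
  Cinf_bar (U `*` [set: 'rV[R]_n])
    (fun z : 'rV[R]_n * 'rV[R]_n => H z.1 z.2) ->
  (forall x, boundary U x -> 0 <= psi x) ->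
  penalization gamma ->
  (exists beta : R,
    [/\ 0 < beta,
        tends_to_pinfty_unif (closure U)
          (fun x p => beta * `|H x p| ^+ 2
                      + dotv (grad_bar U (fun y => H y p) x) p) &
        tends_to_pinfty_unif (closure U) (fun x p => H x p / enorm p)]) ->
  (exists Phi : 'rV[R]_n -> R,
    [/\ Ck 2 U Phi /\ Ck_bar 1 U Phi,
        forall x, closure U x -> Phi x <= psi x,
        forall x, boundary U x -> Phi x = 0 &
        forall x, closure U x -> Phi x + H x (grad_bar U Phi x) < 0]) ->
  0 < eps1 ->
  (forall eps : R, 0 < eps -> eps < eps1 ->
    penalized_solution U H psi gamma eps (ueps eps)) ->
  obstacle_viscosity_solution U H psi u ->
  (exists e : nat -> R,
    [/\ forall k, 0 < e k < eps1,
        e k @[k --> \oo] --> 0 &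
        {uniform closure U, (fun k => ueps (e k)) @ \oo --> u}]) ->
  exists eps0 C : R,
    [/\ 0 < eps0, eps0 <= eps1, 0 < C &
        forall eps : R, 0 < eps -> eps < eps0 ->
          (Linfty_norm U (fun x => ueps eps x - u x)%R
           <= (C * Num.sqrt eps)%:E)%E].
Proof.
move=> n2 [_ oU _ bU sU] Cpsi CH _ pen [_ [_ _ Hinf]].
move=> [Phi [[_ CPhi] Phipsi Phi0 sub]] eps10 sol _ [e [e_bnd e0 eu]].
have [s0 [C [s00 C0 close]]] := penalized_solutions_close (ltnW n2) oU bU sU
  (Cpsi 1%N) (CH 1%N) pen Hinf CPhi Phipsi Phi0 sub.
exists (Num.min eps1 (s0 ^+ 2)), C; split => //.
- by rewrite lt_min eps10 exprn_gt0.
- by rewrite ge_min lexx.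
move=> eps eps0; rewrite lt_min => /andP[epseps1 epss0].
set s := Num.sqrt eps.
have sp : 0 < s by rewrite sqrtr_gt0.
have s2 : s ^+ 2 = eps by rewrite sqr_sqrtr// ltW.
have ss0 : s < s0.
  rewrite ltNge; apply/negP => s0s; move: epss0; rewrite -s2 ltNge.
  by rewrite lerXn2r ?nnegrE ?(ltW sp) ?(ltW s00).
apply: ge_ereal_sup => _ [x Ux <-]; rewrite lee_fin.
have ux : ueps (e k) x @[k --> \oo] --> u x.
  have xcl : [set x] `<=` closure U by move=> _ ->; exact: subset_closure.
  have : {uniform [set x], (fun k => ueps (e k)) @ \oo --> u}.
    by apply: (uniform_subset_cvg (A := closure U)).
  by rewrite uniform_set1.
have dx : `|ueps eps x - ueps (e k) x| @[k --> \oo] --> `|ueps eps x - u x|.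
  by apply: cvg_norm; apply: cvgB => //; exact: cvg_cst.
have cs : (fun=> C * s) @ \oo --> C * s by exact: cvg_cst.
apply: (ler_cvg_to dx cs).
have eeps : \forall k \near \oo, e k < eps.
  by apply: (cvgr_lt 0).
apply: filterS eeps => k ek; have /andP[ek0 ek1] := e_bnd k.
have solk := sol (e k) ek0 ek1; have soleps := sol eps eps0 epseps1.
have le1 := close s eps (e k) _ _ sp ss0 eps0 ltac:(by rewrite s2) ek0
  ltac:(by rewrite s2 ltW) soleps solk x Ux.
have le2 := close s (e k) eps _ _ sp ss0 ek0 ltac:(by rewrite s2 ltW) eps0
  ltac:(by rewrite s2) solk soleps x Ux.
rewrite ler_norml; apply/andP; split; lra.
Qed.
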